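(* Let $d,n\ge2$, $\beta>0$, $m>0$, $\alpha=1/(1+m^2)\in(0,1)$, $\mathcal X=\{0,1,\ldots,n-1\}^d$ with no boundary ($\partial=\emptyset$), $\zeta=e^{2\pi\sqrt{-1}/n}$, and let $J_1,\ldots,J_d$, $H$, $P$, $\lambda_i$, $\kappa_i$ be as in the context. Let $G_{\alpha,\emptyset}(x,x')=\sum_{t=0}^\infty\alpha^t(P^t)_{x,x'}=(I-\alpha P)^{-1}_{x,x'}$ be the Green function. For $(x,x')\in\mathcal X\times\mathcal X$, we have the expansion of the Green function $$\alpha G_{\alpha,\emptyset}(x,x')=\sum_{y\in\mathcal X}\frac1{1/\alpha-\lambda_{\rho(y)}}\,\frac{\zeta^{x\cdot y}}{\sqrt{n^d}}\,\frac{\zeta^{-x'\cdot y}}{\sqrt{n^d}} .$$ Let $(Z_x)_{x\in\mathcal X}$ be Hermitian Gaussian random variables on $\mathcal X$ (defined in the context). Then $$g_x=\frac1{\sqrt\beta}\sum_{y\in\mathcal X}\frac{Z_y}{\sqrt{1/\alpha-\lambda_{\rho(y)}}}\,\frac{\zeta^{x\cdot y}}{\sqrt{n^d}},\qquad x\in\mathcal X,$$ is a real Gaussian free field given by the Gibbs measure with density proportional to $e^{-\beta H}$ on $\mathbb R^{\mathcal X}$. Here, $1/\alpha-\lambda_i$, $i\in\{0,1,\ldots,d\}$, are the eigenvalues of $I/\alpha-P$ (the $\alpha$-discrete Laplacian $P-I/\alpha$ with the sign reversed) with an orthonormal basis of eigenfunctions $(\zeta^{x\cdot y}/\sqrt{n^d})_{y\in\mathcal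 X}$. The eigenvalues are degenerate; more precisely, for each $y\in\mathcal X$, the eigenfunction $\mathcal X\ni x\mapsto\zeta^{x\cdot y}/\sqrt{n^d}\in\mathbb C$ corresponds to the eigenvalue $1/\alpha-\lambda_{\rho(y)}$, whose multiplicity is $\kappa_{\rho(y)}$.
   Context: $\rho(x,x')=|\{i:x_i\ne x_i'\}|$ is the Hamming distance and $\rho(x)=\rho(0,x)$; $x\cdot y=x_1y_1+\cdots+x_dy_d$; $R_i=\{(x,x')\in\mathcal X\times\mathcal X:\rho(x,x')=i\}$ (ordered pairs); $\kappa_i=\binom di(n-1)^i$. Weights $J_i\ge0$, $i=1,\ldots,d$, satisfy $\sum_{i=1}^d\kappa_iJ_i\le1$. Hamiltonian: $H\{(\xi_x)_{x\in\mathcal X}\}=\frac14\sum_{i=1}^dJ_i\sum_{(x,x')\in R_i}(\xi_x-\xi_{x'})^2+\frac{m^2}2\sum_{x\in\mathcal X}\xi_x^2$. Put $w_i=\kappa_iJ_i$ for $1\le i\le d$, $w_0=1-\sum_{i=1}^dw_i$, let $P$ be the transition matrix $(P)_{x,x'}=w_{\rho(x,x')}/\kappa_{\rho(x,x')}$, and $$\lambda_i=\sum_{j=0}^d\frac{w_j}{\kappa_j}K_j(i),\qquad K_i(j)=\sum_{l=\max(0,i+j-d)}^{\min(i,j)}(-1)^l(n-1)^{i-l}\binom jl\binom{d-j}{i-l}$$ (Krawtchouk polynomials). Hermitian Gaussian random variables on $\mathcal X$: for $y\in\mathcal X$ write $n-y=(n-y_1,\ldots,n-y_d)$, each component understood modulo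 $n$ (so that $n$ is identified with $0$). Let $(Z_y)_{y\in\mathcal X}$ be a set of complex Gaussian random variables. For $y\in\mathcal X\setminus\{0\}$, the real and imaginary parts of $Z_y$ are independent centred Gaussian random variables with variance $1/2$, whereas $Z_0$ is real and follows the standard Gaussian distribution. In addition, they satisfy the reflection symmetry $\mathrm{Re}\,Z_y=\mathrm{Re}\,Z_{n-y}$ and skew-symmetry $\mathrm{Im}\,Z_y=-\mathrm{Im}\,Z_{n-y}$; equivalently, $Z_y=\overline{Z_{n-y}}$ for $y\in\mathcal X$. Apart from these symmetry relations, the corresponding real and imaginary parts are mutually independent.
   Formalization: For nonzero y with n-y=y (even n), Z_y is taken real standard Gaussian, as the stated law contradicts the symmetry; the multiplicity κ_{ρ(y)} is counted per index i, and the eigenspace has dimension κ_{ρ(y)} when λ_{ρ(y)} is not shared by another index (else the κ_i are summed). *)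

(* Defs.v *)
From HB Require Import structures.
From mathcomp Require Import all_boot all_order all_algebra.
From mathcomp Require Import complex.
From mathcomp Require Import all_classical all_reals all_analysis.

Set Implicit Arguments.
Unset Strict Implicit.
Unset Printing Implicit Defensive.

Import Order.TTheory GRing.Theory Num.Theory.
Import numFieldNormedType.Exports.

Local Open Scope classical_set_scope.
Local Open Scope complex_scope.
Local Open Scope ring_scope.

(* Lebesgue measure on R^N = N.-tuple R, as an iterated product measure.      *)
Section lebesgue_tuple.
Context {R : realType}.
Local Notation mR := (measurableTypeR R).

Definition tcons N (p : mR * N.-tuple mR) : N.+1.-tuple mR :=
  [tuple of p.1 :: p.2].

Lemma measurable_tcons N : measurable_fun [set: mR * N.-tuple mR] (@tcons N).
Proof. exact: measurable_cons. Qed.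

Section step.
Variables (N : nat) (mu : {sigma_finite_measure set (N.-tuple mR) -> \bar R}).

Definition lebesgue_tupleS : set (N.+1.-tuple mR) -> \bar R :=
  pushforward (lebesgue_measure \x mu)%E (@tcons N).

Let lebesgue_tupleS0 : lebesgue_tupleS set0 = 0%E.
Proof. by rewrite /lebesgue_tupleS /pushforward preimage_set0 measure0. Qed.

Let lebesgue_tupleS_ge0 A : (0 <= lebesgue_tupleS A)%E.
Proof. by rewrite /lebesgue_tupleS /pushforward measure_ge0. Qed.

Let preimage_tcons (A : set (N.+1.-tuple mR)) :
  measurable A -> measurable (@tcons N @^-1` A).
Proof. by move=> mA; rewrite -[X in measurable X]setTI; exact: measurable_tcons. Qed.

Let lebesgue_tupleS_sigma_additive : semi_sigma_additive lebesgue_tupleS.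
Proof.
move=> F mF tF mUF; rewrite /lebesgue_tupleS /pushforward preimage_bigcup.
apply: measure_semi_sigma_additive.
- by move=> k; exact: preimage_tcons.
- apply/trivIsetP => /= i j _ _ ij; rewrite -preimage_setI.
  by move/trivIsetP : tF => /(_ _ _ _ _ ij) ->//; rewrite preimage_set0.
- by rewrite -preimage_bigcup; exact: preimage_tcons.
Qed.

HB.instance Definition _ := isMeasure.Build _ _ _ lebesgue_tupleS
  lebesgue_tupleS0 lebesgue_tupleS_ge0 lebesgue_tupleS_sigma_additive.

Let lebesgue_tupleS_sigma_finite : sigma_finite setT lebesgue_tupleS.
Proof.
have /sigma_finiteP[F [TF ndF Foo]] := sigma_finiteT (@lebesgue_measure R).
have /sigma_finiteP[G [TG ndG Goo]] := sigma_finiteT mu.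
pose g (v : N.+1.-tuple mR) : mR * N.-tuple mR := (thead v, [tuple of behead v]).
have gK p : g (tcons p) = p.
  by case: p => a t; rewrite /g /tcons/= theadE; congr pair; exact/val_inj.
have mg : measurable_fun setT g.
  by apply/measurable_fun_pair; [exact: measurable_tnth|exact: measurable_behead].
exists (fun k => g @^-1` (F k `*` G k)).
  rewrite -preimage_bigcup predeqE => v; split=> // _ /=.
  have : [set: mR] (g v).1 by []. rewrite {1}TF => -[k _ Fk].
  have : [set: N.-tuple mR] (g v).2 by []. rewrite {1}TG => -[l _ Gl].
  exists (maxn k l) => //; split => /=.
  - by move: Fk; exact/subsetPset/ndF/leq_maxl.
  - by move: Gl; exact/subsetPset/ndG/leq_maxr.
move=> k; have [mF Fk] := Foo k; have [mG Gk] := Goo k; split.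
  by rewrite -[X in measurable X]setTI; apply: mg => //; exact: measurableX.
rewrite /lebesgue_tupleS /pushforward.
rewrite (_ : _ @^-1` _ = F k `*` G k); last first.
  by rewrite -comp_preimage (_ : g \o _ = id) ?preimage_id//; exact/funext.
by rewrite product_measure1E// lte_mul_pinfty// ge0_fin_numE.
Qed.

HB.instance Definition _ := Measure_isSigmaFinite.Build _ _ _ lebesgue_tupleS
  lebesgue_tupleS_sigma_finite.

End step.

Fixpoint lebesgue_tuple (N : nat) :
    {sigma_finite_measure set (N.-tuple mR) -> \bar R} :=
  match N with
  | 0 => \d_([tuple] : 0.-tuple mR)
  | N'.+1 => lebesgue_tupleS (lebesgue_tuple N')
  end.

End lebesgue_tuple.

(* The index set {0, .., n-1}^d; for 1 < n the type 'Z_n is 'I_n with         *)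
(* arithmetic mod n, so that 0 is the origin and - y is "n - y".              *)
Definition cube (d n : nat) := {ffun 'I_d -> 'Z_n}.
HB.instance Definition _ d n := Finite.on (cube d n).
HB.instance Definition _ d n := GRing.Zmodule.on (cube d n).

Definition hdist d n (x x' : cube d n) : nat := #|[pred i | x i != x' i]|.

Definition hweight d n (x : cube d n) : nat := hdist 0 x.

(* A sum of natural numbers, not reduced mod n.                               *)
Definition dot d n (x y : cube d n) : nat := (\sum_(i < d) x i * y i)%N.

Definition kappa (d n i : nat) : nat := ('C(d, i) * (n - 1) ^ i)%N.

Section model.
Variables (R : realType) (d n : nat).
Local Notation X := (cube d n).
Implicit Types (J : nat -> R) (x y : X) (alpha beta m : R).

Definition hamiltonian J m (xi : X -> R) : R :=
  4^-1 * (\sum_(1 <= i < d.+1)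
            J i * \sum_(p : X * X | hdist p.1 p.2 == i) (xi p.1 - xi p.2) ^+ 2)
  + m ^+ 2 / 2 * \sum_(x : X) xi x ^+ 2.

Definition krawtchouk (i j : nat) : R :=
  \sum_(i + j - d <= l < (minn i j).+1)
    (-1) ^+ l * (n - 1)%:R ^+ (i - l) * 'C(j, l)%:R * 'C(d - j, i - l)%:R.

Definition weight J (i : nat) : R :=
  if i == 0 then 1 - \sum_(1 <= j < d.+1) (kappa d n j)%:R * J j
  else (kappa d n i)%:R * J i.

Definition lambda J (i : nat) : R :=
  \sum_(0 <= j < d.+1) weight J j / (kappa d n j)%:R * krawtchouk j i.

(* Matrices over the index set are 'M_#|X|, with rows and columns numbered    *)
(* by enum_rank / enum_val; entry A x x' reads off the (x, x') coefficient.   *)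
Definition entry (A : 'M[R]_#|X|) x x' : R := A (enum_rank x) (enum_rank x').

Definition transition J : 'M[R]_#|X| := \matrix_(a, b)
  let i := hdist (enum_val a) (enum_val b) in weight J i / (kappa d n i)%:R.

Definition green_series alpha J x x' : R^nat :=
  series (fun t => alpha ^+ t * entry (transition J ^+ t) x x').

Definition green alpha J x x' : R := limn (green_series alpha J x x').

Definition zeta : R[i] :=
  cos (2 * pi / n%:R) +i* sin (2 * pi / n%:R).

Definition eigenfun y x : R[i] := zeta ^+ dot x y / (Num.sqrt (n ^ d)%:R)%:C.

Definition eigencol y : 'cV[R[i]]_#|X| := \col_a eigenfun y (enum_val a).

(* I / alpha - P, as a complex matrix.                                        *)
Definition laplacian alpha J : 'M[R[i]]_#|X| :=
  map_mx (real_complex R) (alpha^-1%:M - transition J).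

Definition gibbs_density beta J m (v : #|X|.-tuple (measurableTypeR R)) : R :=
  expR (- beta * hamiltonian J m (fun x => tnth v (enum_rank x))).

Definition partition_function beta J m : \bar R :=
  (\int[lebesgue_tuple #|X|]_v (gibbs_density beta J m v)%:E)%E.

Definition gibbs beta J m (B : set (#|X|.-tuple (measurableTypeR R))) : \bar R :=
  ((fine (partition_function beta J m))^-1%:E *
   \int[lebesgue_tuple #|X|]_(v in B) (gibbs_density beta J m v)%:E)%E.

Section random.
Context (disp : measure_display) (T : measurableType disp).
Variable P : probability T R.

Definition mutually_independent (I : finType) (A : {set I}) (Y : I -> T -> R) :=
  forall (A' : {set I}) (B : I -> set (measurableTypeR R)),
    A' \subset A -> (forall i, measurable (B i)) ->
    P (\bigcap_(i in [set` A']) (Y i @^-1` B i)) =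
    (\prod_(i in A') P (Y i @^-1` B i))%E.

Definition has_law (Y : T -> R) (mu : set (measurableTypeR R) -> \bar R) :=
  forall B : set (measurableTypeR R), measurable B -> P (Y @^-1` B) = mu B.

(* Real part (b = false) or imaginary part (b = true).                        *)
Definition part (b : bool) (z : R[i]) : R := if b then complex.Im z else complex.Re z.

(* For even n there are nonzero y with n - y = y; the symmetry forces such a  *)
(* Z_y to be real, and it is then standard Gaussian, like Z_0. Independence   *)
(* "apart from the symmetry" is independence along every set S of indices     *)
(* that contains at most one of y and n - y. normal_prob takes the mean and   *)
(* the standard deviation.                                                    *)
Record hermitian_gaussian (Z : X -> T -> R[i]) : Prop := HermitianGaussian {
  hermitian_measurable : forall b y,
    measurable_fun setT (part b \o Z y : T -> measurableTypeR R) ;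
  hermitian_sym : forall y, {ae P, forall w, Z y w = conjc (Z (- y) w)} ;
  hermitian_law : forall b y, - y != y ->
    has_law (part b \o Z y) (normal_prob 0 (Num.sqrt (2^-1))) ;
  hermitian_law_real : forall y, - y = y ->
    has_law (part false \o Z y) (normal_prob 0 1) ;
  hermitian_indep : forall S : {set X},
    (forall y, y \in S -> - y \in S -> - y = y) ->
    mutually_independent (finset (fun p : bool * X => p.2 \in S))
      (fun p => part p.1 \o Z p.2)
}.

Definition gff alpha beta J (Z : X -> T -> R[i]) x (w : T) : R[i] :=
  (Num.sqrt beta)^-1%:C *
  \sum_(y : X) Z y w / (Num.sqrt (alpha^-1 - lambda J (hweight y)))%:C *
    eigenfun y x.

(* The real-valued field (Re g_x)_x as a random vector.                       *)
Definition real_gff alpha beta J (Z : X -> T -> R[i]) (w : T) :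
    #|X|.-tuple (measurableTypeR R) :=
  [tuple complex.Re (gff alpha beta J Z (enum_val a) w) | a < #|X|].

End random.
End model.

(* Main.v *)
From HB Require Import structures.
Require Import Defs.
From mathcomp Require Import all_boot all_order all_algebra.
From mathcomp Require Import complex ring lra zify measurable_realfun.
From mathcomp Require Import all_classical all_reals all_analysis.

(* The characters zeta^(x.y) diagonalise every matrix whose entries depend only
   on the Hamming distance; the eigenvalue is a sum of characters over spheres,
   and the generating function of these sphere sums is that of the Krawtchouk
   polynomials. With w_j >= 0 summing to 1 this gives |lambda_i| <= 1, so the
   Green function is a geometric series in each Fourier mode.

   For the field, one member of each pair {y, - y} is selected; Re Z_y and
   Im Z_y at the selected points form N = n^d independent centred Gaussian
   coordinates v, with standard deviations s. Then g = A v almost surely for a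
   real matrix A, and by Parseval beta H (A v) = 1/2 sum_y (v_y / s_y)^2. Hence A
   is invertible, and the density of v is a multiple of exp(- beta H (A v)). As A
   multiplies Lebesgue measure by a positive constant, the law of g has density
   proportional to exp(- beta H), the constant being fixed by total mass. *)

(** The law is found by transporting a density, not through covariances, so the Gibbs form comes out
    directly and no determinant of the Fourier transform is computed. The obstacle is the redundancy
    of the complex family Z: its symmetry holds only almost surely, and it makes Z_y real at the
    fixed points of y -> - y, whose number depends on the parity of n. The count of real coordinates
    is n^d all the same: two for each genuine pair {y, - y}, one for each fixed point. The variances
    fit as well. In the sum of |Z_y|^2 a genuine pair contributes its real and imaginary squares
    twice, which matches variance 1/2; a fixed point contributes once, which matches variance 1.
    This is why the Parseval sum is exactly the exponent of a product of normal densities. *)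

Import Order.TTheory GRing.Theory Num.Theory.
Import numFieldNormedType.Exports.

Local Open Scope classical_set_scope.
Local Open Scope complex_scope.
Local Open Scope ring_scope.

(* The library's measure structure on [pushforward m f] has the measurability
   proof as an argument that unification cannot recover. *)
Definition pushforward_measure d d' (T1 : measurableType d)
    (T2 : measurableType d') (R : realType) (m : {measure set T1 -> \bar R})
    (f : T1 -> T2) (mf : measurable_fun [set: T1] f) :
    {measure set T2 -> \bar R} :=
  measure_function_pushforward__canonical__measure_function_Measure m mf.
Arguments pushforward_measure {d d' T1 T2 R} m {f} mf.

(** * Lebesgue measure on tuples under invertible linear maps *)

Section lebesgue_linear.
Set Implicit Arguments.
Unset Strict Implicit.
Unset Printing Implicit Defensive.
Context {R : realType}.
Local Notation mR := (measurableTypeR R).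
Local Notation leb := (@lebesgue_measure R).

(** By uniqueness of Lebesgue measure it suffices to test half-open intervals. For negative [a] the
    preimage is closed at the other end, which leaves its length unchanged. *)
Lemma lebesgue_affine (a b : R) (B : set mR) : a != 0 -> measurable B ->
  leb ((fun x : mR => a * x + b) @^-1` B) = (`|a|^-1%:E * leb B)%E.
Proof.
move=> a0 mB.
have mf : measurable_fun setT ((fun x : mR => a * x + b) : mR -> mR).
  by apply: measurable_funD => //; apply: measurable_funM.
have a0' : 0 <= `|a| by [].
pose mu := mscale (NngNum a0') (pushforward_measure leb mf).
suff -> : leb B = mu B.
  by rewrite /mu /mscale/= muleA -EFinM mulVf ?normr_eq0// mul1e.
apply: lebesgue_measure_unique => // _ [[x y] /= _ <-].
rewrite /mu /mscale/= /pushforward/= [in LHS]lebesgue_measure_itv/=.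
have [a_gt0|a_lt0|] := ltgtP 0 a; last by move=> aE; rewrite -aE eqxx in a0.
- rewrite (_ : _ @^-1` _ = `](x - b) / a, (y - b) / a]%classic); last first.
    apply/seteqP; split=> t /=; rewrite !in_itv/= ltr_pdivrMr// ler_pdivlMr//;
    by rewrite ltrBlDr lerBrDr mulrC.
  rewrite lebesgue_measure_itv/= !lte_fin gtr0_norm//.
  rewrite ltr_pM2r ?invr_gt0// ltrD2r; case: ifP => _; last by rewrite mule0.
  by rewrite -!EFinB -EFinM; congr EFin; field; lra.
- rewrite (_ : _ @^-1` _ = `[(y - b) / a, (x - b) / a[%classic); last first.
    apply/seteqP; split=> t /=; rewrite !in_itv/= ltr_ndivlMr// ler_ndivrMr//;
    by rewrite ltrBlDr lerBrDr mulrC andbC.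
  rewrite lebesgue_measure_itv/= !lte_fin ltr0_norm//.
  rewrite ltr_nM2r ?invr_lt0// ltrD2r; case: ifP => _; last by rewrite mule0.
  by rewrite -!EFinB -EFinM; congr EFin; field; lra.
Qed.

Local Notation mu := (@lebesgue_tuple R).

Lemma lebesgue_tuple_xsection N (B : set (N.+1.-tuple mR)) :
  mu N.+1 B = (\int[leb]_x mu N [set t | B (tcons (x, t))])%E.
Proof.
rewrite /= /lebesgue_tupleS /pushforward/= /product_measure1/=.
apply: eq_integral => x _; congr (mu N _).
by apply/seteqP; split=> t /=; rewrite /xsection/= inE.
Qed.

Lemma measurable_lebesgue_ysection N (B : set (N.+1.-tuple mR)) :
  measurable B -> measurable_fun setT
    (fun t : N.-tuple mR => leb [set x | B (tcons (x, t))]).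
Proof.
move=> mB.
have mB' : measurable (@tcons R N @^-1` B).
  by rewrite -[X in measurable X]setTI; exact: measurable_tcons.
have := measurable_fun_ysection leb mB'; congr measurable_fun.
apply/funext => t/=; congr (leb _).
by apply/seteqP; split=> x /=; rewrite /ysection/= inE.
Qed.

(** The product measure is defined through x-sections; Tonelli allows the other order, needed when
    the first coordinate is transformed with the tail held fixed. *)
Lemma lebesgue_tuple_ysection N (B : set (N.+1.-tuple mR)) : measurable B ->
  mu N.+1 B = (\int[mu N]_t leb [set x | B (tcons (x, t))])%E.
Proof.
move=> mB.
have mB' : measurable (@tcons R N @^-1` B).
  by rewrite -[X in measurable X]setTI; exact: measurable_tcons.
transitivity (((leb \x mu N) (@tcons R N @^-1` B))%E : \bar R) => //.
have := @indic_fubini_tonelli _ _ _ _ R leb (mu N) _ mB'.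
rewrite indic_fubini_tonelli_FE// indic_fubini_tonelli_GE//.
rewrite /product_measure1 => ->.
apply: eq_integral => t _ /=; congr (leb _).
by apply/seteqP; split=> x /=; rewrite /ysection/= inE.
Qed.

(** Preimages are measured, so for an invertible linear map [c] is the inverse of the absolute
    determinant. *)
Definition scales_lebesgue N (f : N.-tuple mR -> N.-tuple mR) (c : R) :=
  [/\ measurable_fun setT f, 0 < c &
    forall B, measurable B -> mu N (f @^-1` B) = (c%:E * mu N B)%E].

Lemma scales_lebesgue_comp N (f g : N.-tuple mR -> N.-tuple mR) c e :
  scales_lebesgue f c -> scales_lebesgue g e ->
  scales_lebesgue (f \o g) (e * c).
Proof.
move=> [mf c0 fB] [mg e0 gB]; split=> [||B mB].
- exact: measurableT_comp.
- exact: mulr_gt0.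
- rewrite comp_preimage gB; last by rewrite -[X in measurable X]setTI; exact: mf.
  by rewrite fB// muleA EFinM.
Qed.

Lemma scales_lebesgue_integral N f c (D : set (N.-tuple mR)) g :
  scales_lebesgue f c -> measurable D -> measurable_fun D g ->
  (forall t, D t -> 0 <= g t)%E ->
  (\int[mu N]_(t in f @^-1` D) g (f t) = c%:E * \int[mu N]_(t in D) g t)%E.
Proof.
move=> [mf c0 fB] mD mg g0.
have g0' : {in D, forall t, 0 <= g t}%E by move=> t; rewrite inE => /g0.
have c0' : 0 <= c by exact: ltW.
have := ge0_integral_pushforward mf (mu N) mD mg g0' => <-.
rewrite -(ge0_integral_mscale _ _ (NngNum c0'))//.
by apply: eq_measure_integral => A mA _; exact: fB.
Qed.

Definition linmap N (M : 'M[R]_N) (v : N.-tuple mR) : N.-tuple mR :=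
  [tuple \sum_j M i j * tnth v j | i < N].

Lemma linmapM N (M M' : 'M[R]_N) : linmap (M *m M') = linmap M \o linmap M'.
Proof.
apply/funext => v; apply/eq_from_tnth => i; rewrite /= !tnth_mktuple.
under eq_bigr do rewrite !mxE mulr_suml.
rewrite exchange_big; apply: eq_bigr => k _ /=; rewrite tnth_mktuple mulr_sumr.
by apply: eq_bigr => j _; rewrite mulrA.
Qed.

Lemma measurable_linmap N (M : 'M[R]_N) : measurable_fun setT (linmap M).
Proof.
apply/measurable_fun_tnthP => i.
rewrite (_ : _ \o _ = fun v => \sum_j M i j * tnth v j); last first.
  by apply/funext => v /=; rewrite tnth_mktuple.
apply: measurable_sum => // j; apply: measurable_funM => //.
exact: measurable_tnth.
Qed.

Definition tshift N (u v : N.-tuple mR) : N.-tuple mR :=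
  [tuple tnth v i + tnth u i | i < N].

Lemma measurable_tshift N (u : N.-tuple mR) : measurable_fun setT (tshift u).
Proof.
apply/measurable_fun_tnthP => i.
rewrite (_ : _ \o _ = fun v => tnth v i + tnth u i); last first.
  by apply/funext => v /=; rewrite tnth_mktuple.
by apply: measurable_funD => //; exact: measurable_tnth.
Qed.

Lemma measurable_tcons_section N (B : set (N.+1.-tuple mR)) (x : R) :
  measurable B -> measurable [set t : N.-tuple mR | B (tcons (x, t))].
Proof.
move=> mB; rewrite -[X in measurable X]setTI.
have mp : measurable_fun setT ((fun t => tcons (x : mR, t)) : N.-tuple mR -> _).
  exact: (measurableT_comp (@measurable_tcons R N) (pair1_measurable x)).
exact: mp.
Qed.

Lemma measurable_tcons_ysection N (B : set (N.+1.-tuple mR)) (t : N.-tuple mR) :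
  measurable B -> measurable [set x : mR | B (tcons (x, t))].
Proof.
move=> mB; rewrite -[X in measurable X]setTI.
have mp : measurable_fun setT ((fun x => tcons (x, t)) : mR -> _).
  exact: (measurableT_comp (@measurable_tcons R N) (pair2_measurable t)).
exact: mp.
Qed.

Lemma tnth_tcons0 N (p : mR * N.-tuple mR) : tnth (tcons p) ord0 = p.1.
Proof. exact: tnth0. Qed.

Lemma tnth_tconsS N (p : mR * N.-tuple mR) i : tnth (tcons p) (lift ord0 i) = tnth p.2 i.
Proof. exact: tnthS. Qed.

Lemma eq_from_tnth0S N (u v : N.+1.-tuple mR) : tnth u ord0 = tnth v ord0 ->
  (forall i, tnth u (lift ord0 i) = tnth v (lift ord0 i)) -> u = v.
Proof.
move=> u0 uS; apply/eq_from_tnth => i; case: (unliftP ord0 i) => [j|] ->//.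
Qed.

(** Serves the lower shears: once the first coordinate is fixed, such a shear merely translates the
    tail. *)
Lemma lebesgue_tuple_tshift N (u : N.-tuple mR) (B : set (N.-tuple mR)) :
  measurable B -> mu N (tshift u @^-1` B) = mu N B.
Proof.
elim: N u B => [|N IH] u B mB.
  by congr (_ _); apply/seteqP; split=> v /=; rewrite [tshift _ _]tuple0 [v]tuple0.
have shiftE x t : tshift u (tcons (x, t)) =
    tcons (x + thead u, tshift (behead_tuple u) t).
  apply: eq_from_tnth0S => [|i]; first by rewrite tnth_mktuple !tnth_tcons0.
  rewrite tnth_mktuple !tnth_tconsS tnth_mktuple; congr (_ + _).
  by rewrite [in LHS](tuple_eta u) tnthS.
rewrite !lebesgue_tuple_ysection//; last first.
  by rewrite -[X in measurable X]setTI; exact: measurable_tshift.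
under eq_integral => t _.
  rewrite (_ : [set x | _] = (fun x : mR => 1 * x + thead u) @^-1`
      [set x | B (tcons (x, tshift (behead_tuple u) t))]); last first.
    by apply/seteqP; split=> x /=; rewrite shiftE mul1r.
  rewrite lebesgue_affine ?oner_eq0//; last exact: measurable_tcons_ysection.
  rewrite normr1 invr1 mul1e.
  over.
have tshift1 : scales_lebesgue (tshift (behead_tuple u)) 1.
  split=> [||A mA]; [exact: measurable_tshift|exact: ltr01|].
  by rewrite mul1e IH.
set g := fun t => leb [set x | B (tcons (x, t))].
have := scales_lebesgue_integral (g := g) tshift1 measurableT.
by rewrite preimage_setT mul1e; apply=> //; exact: measurable_lebesgue_ysection.
Qed.

Lemma linmap_block N (A : 'M[R]_1) (r : 'rV[R]_N) (c : 'cV[R]_N) (D : 'M[R]_N)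
    (x : R) (t : N.-tuple mR) :
  linmap (block_mx A r c D : 'M[R]_(1 + N)) (tcons (x, t)) =
  tcons (A 0 0 * x + \sum_j r 0 j * tnth t j,
         tshift [tuple c i 0 * x | i < N] (linmap D t)).
Proof.
have lE : ord0 = lshift N (0 : 'I_1) by exact/val_inj.
have rE (i : 'I_N) : lift ord0 i = rshift 1 i by exact/val_inj.
apply: eq_from_tnth0S => [|i].
- rewrite tnth_mktuple tnth_tcons0/= big_ord_recl tnth_tcons0 {1 2}lE block_mxEul.
  by congr (_ + _); apply: eq_bigr => j _; rewrite tnth_tconsS rE lE block_mxEur.
- rewrite tnth_tconsS !tnth_mktuple/= big_ord_recl tnth_tcons0 rE {1}lE block_mxEdl.
  rewrite addrC; congr (_ + _).
  by apply: eq_bigr => j _; rewrite tnth_tconsS !rE block_mxEdr.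
Qed.

(** With the tail [t] fixed the first coordinate undergoes an affine map of slope [A 0 0], whose
    offset depends on [t] alone; the tail is then moved by [S]. *)
Lemma scales_lebesgue_upper N (A : 'M[R]_1) (r : 'rV[R]_N) (S : 'M[R]_N) c :
  A 0 0 != 0 -> scales_lebesgue (linmap S) c ->
  scales_lebesgue (linmap (block_mx A r 0 S : 'M[R]_(1 + N))) (`|A 0 0|^-1 * c).
Proof.
move=> a0 Sc; split=> [||B mB]; first exact: measurable_linmap.
  by apply: mulr_gt0; [rewrite invr_gt0 normr_gt0|case: Sc].
rewrite !lebesgue_tuple_ysection//; last first.
  by rewrite -[X in measurable X]setTI; exact: measurable_linmap.
under eq_integral => t _.
  rewrite (_ : [set x | _] = (fun x : mR => A 0 0 * x + \sum_j r 0 j * tnth t j)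
      @^-1` [set x | B (tcons (x, linmap S t))]); last first.
    apply/seteqP; split=> x /=; rewrite linmap_block (_ : tshift _ _ = linmap S t)//;
    by apply/eq_from_tnth => i; rewrite !tnth_mktuple mxE mul0r addr0.
  rewrite lebesgue_affine//; last exact: measurable_tcons_ysection.
  over.
set g := fun t => leb [set x | B (tcons (x, t))].
have mg : measurable_fun setT g by exact: measurable_lebesgue_ysection.
have := scales_lebesgue_integral (g := g) Sc measurableT mg (fun _ _ => measure_ge0 _ _).
rewrite preimage_setT EFinM -muleA => <-.
rewrite ge0_integralZl//.
  by apply: (measurableT_comp mg); exact: measurable_linmap.
Qed.

Lemma scales_lebesgue_lower N (c : 'cV[R]_N) :
  scales_lebesgue (linmap (block_mx 1%:M 0 c 1%:M : 'M[R]_(1 + N))) 1.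
Proof.
split=> [||B mB]; [exact: measurable_linmap|exact: ltr01|].
rewrite !lebesgue_tuple_xsection mul1e.
apply: eq_integral => x _.
rewrite -[RHS](lebesgue_tuple_tshift [tuple c i 0 * x | i < N]); last first.
  exact: measurable_tcons_section.
congr (mu N _); apply/seteqP; split=> t /=;
rewrite linmap_block mxE eqxx mulr1n mul1r big1 ?addr0;
  do ?[by move=> j _; rewrite mxE mul0r];
  by rewrite (_ : linmap 1%:M t = t)//; apply/eq_from_tnth => i;
  rewrite tnth_mktuple (bigD1 i)//= mxE eqxx mul1r big1 ?addr0// => j ji;
  rewrite mxE eq_sym (negbTE ji) mul0r.
Qed.

(* Gaussian elimination on the first coordinate: a shear makes the corner entry
   nonzero, and M is then a lower unitriangular block matrix times an upper block
   triangular one. The value of the factor is irrelevant, since Gibbs measures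
   are normalised. *)
Lemma scales_lebesgue_linmap N (M : 'M[R]_N) : M \in unitmx ->
  exists c, scales_lebesgue (linmap M) c.
Proof.
elim: N M => [|N IH] M uM.
  exists 1; split=> [||B mB]; [exact: measurable_linmap|exact: ltr01|].
  rewrite mul1e; congr (mu _ _).
  by apply/seteqP; split=> v /=; rewrite [linmap _ _]tuple0 [v]tuple0.
have corner (M' : 'M[R]_(1 + N)) : M' \in unitmx -> M' 0 0 != 0 ->
    exists c, scales_lebesgue (linmap M') c.
  move=> {uM} uM a0; set a := M' 0 0 in a0.
  pose A := ulsubmx M'; pose r := ursubmx M'; pose c := dlsubmx M'.
  (* Schur complement of the corner entry; it inherits invertibility from the block determinant. *)
  pose S := drsubmx M' - (a^-1 *: c) *m r.
  have AE : A = a%:M.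
    apply/matrixP => i j; rewrite !ord1 !mxE eqxx mulr1n /a.
    by congr (M' _ _); exact/val_inj.
  have M'E : M' = block_mx 1%:M 0 (a^-1 *: c) 1%:M *m block_mx A r 0 S.
    rewrite mulmx_block !mul1mx !mul0mx !addr0.
    rewrite AE mul_mx_scalar scalerA divff// scale1r addrC subrK -AE.
    by rewrite submxK.
  have uS : S \in unitmx.
    move: uM; rewrite M'E unitmx_mul => /andP[_].
    by rewrite !unitmxE det_ublock unitrM => /andP[].
  have [e Se] := IH _ uS; exists (`|A 0 0|^-1 * e * 1).
  rewrite M'E linmapM; apply: scales_lebesgue_comp.
    exact: scales_lebesgue_lower.
  by apply: scales_lebesgue_upper => //; rewrite AE mxE eqxx mulr1n.
have [a0|] := eqVneq (M 0 0) 0; last exact: corner.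
(* Otherwise the first column is zero, and so is the determinant expanded along it. *)
have [i Mi0] : exists i : 'I_N, M (lift ord0 i) 0 != 0.
  apply/existsP; apply: contraLR uM; rewrite negb_exists => /forallP M0.
  rewrite unitmxE (expand_det_col _ 0) big1 ?unitr0// => k _.
  case: (unliftP ord0 k) => [j|] ->; last by rewrite a0 mul0r.
  by move: (M0 j); rewrite negbK => /eqP ->; rewrite mul0r.
pose E (e : 'rV[R]_N) : 'M[R]_(1 + N) := block_mx 1%:M e 0 1%:M.
have EV e : E (- e) *m E e = 1%:M.
  by rewrite mulmx_block !mul1mx !mulmx1 !mul0mx mulmx0 !addr0 add0r subrr
    -scalar_mx_block.
(* Adds row [lift ord0 i] to the first row, so the corner becomes the nonzero entry just found. *)
pose M' := E (delta_mx 0 i) *m M.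
have M'E : M = E (- delta_mx 0 i) *m M' by rewrite mulmxA EV mul1mx.
have [||c Sc] := corner M'.
  - by move: uM; rewrite M'E unitmx_mul => /andP[].
  - have lE : (0 : 'I_N.+1) = lshift N (0 : 'I_1) by exact/val_inj.
    have rE (j : 'I_N) : lift ord0 j = rshift 1 j by exact/val_inj.
    rewrite /M' mxE big_ord_recl a0 mulr0 add0r (bigD1 i)//= big1 ?addr0; last first.
      move=> j ji; rewrite /E {1}lE rE block_mxEur mxE (negbTE ji) andbF mul0r//.
    by rewrite /E {1}lE rE block_mxEur mxE !eqxx mul1r -rE.
(* The inverse shear has corner 1, so the case already proved covers it. *)
have [e Se] : exists e, scales_lebesgue (linmap (E (- delta_mx 0 i))) e.
  apply: corner; first by rewrite unitmxE det_ublock !det1 mulr1 unitr1.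
  have lE : (0 : 'I_N.+1) = lshift N (0 : 'I_1) by exact/val_inj.
  by rewrite /E lE block_mxEul mxE eqxx oner_eq0.
by exists (c * e); rewrite M'E linmapM; exact: scales_lebesgue_comp.
Qed.

End lebesgue_linear.

(** * Joint laws of independent variables with densities *)

Section density.
Context d (T : measurableType d) (R : realType).
Variables (m : {measure set T -> \bar R}) (f : T -> R).
Hypotheses (f0 : forall x, 0 <= f x) (mf : measurable_fun setT f).

(** Made into a measure so that a law can be identified with it by uniqueness on boxes. *)
Definition density (A : set T) : \bar R := (\int[m]_(x in A) (f x)%:E)%E.

Let density0 : density set0 = 0%E.
Proof. by rewrite /density integral_set0. Qed.

Let density_ge0 A : (0 <= density A)%E.
Proof. by apply: integral_ge0 => x _; rewrite lee_fin. Qed.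

Let density_sigma_additive : semi_sigma_additive density.
Proof.
move=> F mF tF mUF; rewrite /density ge0_integral_bigcup//.
- by apply: is_cvg_ereal_nneg_natsum_cond => k _ _; exact: density_ge0.
- by apply/measurable_EFinP; exact: measurable_funTS.
- by move=> x _; rewrite lee_fin.
Qed.

HB.instance Definition _ := isMeasure.Build _ _ _ density
  density0 density_ge0 density_sigma_additive.

Definition density_measure : {measure set T -> \bar R} := density.

End density.
Arguments density_measure {d T R} m {f} f0 mf.

Section independent_densities.
Set Implicit Arguments.
Unset Strict Implicit.
Unset Printing Implicit Defensive.
Context {R : realType}.
Local Notation mR := (measurableTypeR R).
Local Notation leb := (@lebesgue_measure R).
Local Notation mu := (@lebesgue_tuple R).

Lemma integral_tcons N (f : N.+1.-tuple mR -> \bar R) :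
  measurable_fun setT f -> (forall v, 0 <= f v)%E ->
  (\int[mu N.+1]_v f v = \int[leb]_x \int[mu N]_t f (tcons (x, t)))%E.
Proof.
move=> mf f0.
have := @ge0_integral_pushforward _ _ _ _ R _ (@measurable_tcons R N)
  (leb \x mu N)%E setT f measurableT mf (fun v _ => f0 v).
rewrite preimage_setT => ->.
rewrite fubini_tonelli1//; last by move=> x; exact: f0.
by apply: (measurableT_comp mf); exact: measurable_tcons.
Qed.

Lemma measurable_tuple_prod N (g : 'I_N -> mR -> R) :
  (forall i, measurable_fun setT (g i)) ->
  measurable_fun setT (fun v : N.-tuple mR => \prod_i g i (tnth v i)).
Proof.
move=> mg; apply: measurable_prod => i _.
by apply: (measurableT_comp (mg i)); exact: measurable_tnth.
Qed.

Lemma integral_tuple_prod N (g : 'I_N -> mR -> R) :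
  (forall i, measurable_fun setT (g i)) -> (forall i x, 0 <= g i x) ->
  (\int[mu N]_v (\prod_i g i (tnth v i))%:E = \prod_i \int[leb]_x (g i x)%:E)%E.
Proof.
elim: N g => [|N IH] g mg g0.
  rewrite big_ord0 integral_dirac//=; first by rewrite diracT mul1e big_ord0.
  by apply/measurable_EFinP; exact: measurable_tuple_prod.
rewrite integral_tcons; last 2 first.
- by apply/measurable_EFinP; exact: measurable_tuple_prod.
- by move=> v; rewrite lee_fin prodr_ge0.
under eq_integral => x _.
  under eq_integral => t _.
    rewrite big_ord_recl tnth_tcons0/= EFinM.
    under eq_bigr do rewrite tnth_tconsS/=.
    over.
  rewrite ge0_integralZl//; last 3 first.
  - by apply/measurable_EFinP; exact: (measurable_tuple_prod (fun i => mg _)).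
  - by move=> t _; rewrite lee_fin prodr_ge0.
  - by rewrite lee_fin.
  rewrite (IH (fun i => g (lift ord0 i)))//.
  over.
rewrite ge0_integralZr//.
- by rewrite big_ord_recl.
- exact/measurable_EFinP.
- by move=> x _; rewrite lee_fin.
- by apply: prode_ge0 => i _; apply: integral_ge0 => x _; rewrite lee_fin.
Qed.

Definition box N (B : 'I_N -> set mR) : set (N.-tuple mR) :=
  [set v | forall i, B i (tnth v i)].

Lemma measurable_box N (B : 'I_N -> set mR) :
  (forall i, measurable (B i)) -> measurable (box B).
Proof.
move=> mB.
rewrite (_ : box B = \bigcap_(i in setT) ((@tnth N mR)^~ i @^-1` B i)); last first.
  by apply/seteqP; split=> v vB i; [move=> _; exact: vB|exact: (vB i)].
apply: fin_bigcap_measurable => //= i _.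
by rewrite -[X in measurable X]setTI; exact: measurable_tnth.
Qed.

Lemma measurable_tuple_boxes N :
  @measurable _ (N.-tuple mR) =
  <<s [set A | exists2 B : 'I_N -> set mR, (forall i, measurable (B i)) & A = box B] >>.
Proof.
apply/seteqP; split.
- apply: smallest_sub; first exact: smallest_sigma_algebra.
  rewrite -bigcup_seq; apply: bigcup_sub => i _ _ [A mA <-].
  (* A coordinate preimage is a box with a single restricted side. *)
  apply: sub_sigma_algebra; exists (fun j => if j == i then A else setT).
    by move=> j; case: ifP.
  apply/seteqP; split=> v /=; first by move=> [_ vA] j; case: eqP => // ->.
  by move=> /(_ i); rewrite eqxx.
- apply: smallest_sub; first exact: sigma_algebra_measurable.
  by move=> _ [B mB ->]; exact: measurable_box.
Qed.

(** Both sides are measures, and boxes are stable under intersection and generate the sigma-algebra,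
    so equality on boxes is enough. *)
Lemma law_independent_densities N (f : 'I_N -> mR -> R) disp
    (T : measurableType disp) (P : probability T R) (V : 'I_N -> T -> mR) :
  (forall i x, 0 <= f i x) -> (forall i, measurable_fun setT (f i)) ->
  (forall i, measurable_fun setT (V i)) ->
  (forall i B, measurable B ->
     P (V i @^-1` B) = \int[leb]_(x in B) (f i x)%:E)%E ->
  (forall B : 'I_N -> set mR, (forall i, measurable (B i)) ->
     P (\bigcap_(i in setT) (V i @^-1` B i)) = \prod_i P (V i @^-1` B i))%E ->
  forall B, measurable B ->
  P ((fun w => [tuple V i w | i < N] : N.-tuple mR) @^-1` B) =
  (\int[mu N]_(v in B) (\prod_i f i (tnth v i))%:E)%E.
Proof.
move=> f0 mf mV VE indep.
have mVt : measurable_fun setT (fun w => [tuple V i w | i < N] : N.-tuple mR).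
  apply/measurable_fun_tnthP => i; rewrite (_ : _ \o _ = V i)//.
  by apply/funext => w /=; rewrite tnth_mktuple.
have F0 (v : N.-tuple mR) : 0 <= \prod_i f i (tnth v i) by rewrite prodr_ge0.
have mF := measurable_tuple_prod mf.
pose m1 := pushforward_measure P mVt.
pose m2 := density_measure (mu N) F0 mF.
move=> B mB.
apply: (@measure_unique _ R _ _ (fun=> setT) (measurable_tuple_boxes N) _ _ _
  m1 m2 _ _ B mB).
- move=> _ _ [A mA ->] [C mC ->]; exists (fun i => A i `&` C i).
    by move=> i; exact: measurableI.
  apply/seteqP; split=> v /=; first by move=> [vA vC] i; split.
  by move=> vAC; split=> i; have [] := vAC i.
- by move=> _; exists (fun=> setT) => //; apply/seteqP; split.
- by rewrite bigcup_const//; exists 0%N.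
- move=> _ [A mA ->].
  transitivity (P (\bigcap_(i in setT) (V i @^-1` A i))).
    congr (P _); apply/seteqP; split=> w /=.
      by move=> wA i _; have := wA i; rewrite tnth_mktuple.
    by move=> wA i; rewrite tnth_mktuple; exact: wA.
  rewrite indep//; under eq_bigr do rewrite VE//.
  rewrite /m2 /density_measure /= /density integral_mkcond.
  (* The indicator of a box is the product of the indicators of its sides, so the integrand on a box
     is again a product over coordinates. *)
  under [RHS]eq_integral => v _.
    rewrite (_ : patch _ _ _ _ = (\prod_i (f i (tnth v i) * \1_(A i) (tnth v i)))%:E).
      over.
    rewrite patchE; case: ifPn => [|]; [rewrite inE|rewrite notin_setE] => vA.
      congr EFin; apply: eq_bigr => i _; rewrite indicE mem_set ?mulr1//.
    congr EFin; apply/esym.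
    have /existsNP[i vAi] := vA.
    by rewrite (bigD1 i)//= indicE memNset// mulr0 mul0r.
  rewrite (integral_tuple_prod (g := fun i x => f i x * \1_(A i) x))//.
  + apply: eq_bigr => i _; rewrite integral_mkcond; apply: eq_integral => x _.
    rewrite patchE indicE; case: ifPn => _; first by rewrite mulr1.
    by rewrite mulr0.
  + by move=> i; apply: measurable_funM => //; exact: measurable_indic.
  + by move=> i x; rewrite mulr_ge0.
- by move=> _; rewrite /m1 /pushforward_measure/= /pushforward preimage_setT
    probability_setT ltry.
Qed.

End independent_densities.

(** * Characters of the cube and Krawtchouk polynomials *)

Section characters.
Set Implicit Arguments.
Unset Strict Implicit.
Unset Printing Implicit Defensive.
Variables (R : realType) (d n : nat).
Hypothesis hn : (2 <= n)%N.
Local Notation X := (cube d n).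
Local Notation C := R[i].
Local Notation zeta := (zeta R n).

Lemma zetaX k : zeta ^+ k =
  cos (2 * pi / n%:R * k%:R) +i* sin (2 * pi / n%:R * k%:R).
Proof.
elim: k => [|k IH]; first by rewrite expr0 mulr0 cos0 sin0.
rewrite exprSr IH /Defs.zeta; apply/eqP; rewrite eq_complex/= -[k.+1%:R]natr1.
rewrite [_ * (k%:R + 1)]mulrDr mulr1.
by rewrite cosD sinD eqxx addrC eqxx.
Qed.

Lemma zetaXn : zeta ^+ n = 1.
Proof.
have n0 : n%:R != 0 :> R by rewrite pnatr_eq0 -lt0n ltnW.
by rewrite zetaX divfK// mulrC mulr_natr cos2pi sin2pi.
Qed.

(** The real part is cos(2t) = 1 - 2 sin(t)^2 with t = pi k / n strictly between 0 and pi, hence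
    less than 1. *)
Lemma zetaX_neq1 k : (0 < k < n)%N -> zeta ^+ k != 1.
Proof.
move=> /andP[k0 kn]; rewrite zetaX eq_complex/= negb_and; apply/orP; left.
have n0 : 0 < n%:R :> R by rewrite ltr0n ltnW.
pose t : R := pi / n%:R * k%:R.
have -> : 2 * pi / n%:R * k%:R = t *+ 2 by rewrite /t; ring.
rewrite cos_mulr2n.
have st : 0 < sin t.
  apply: sin_gt0_pi; rewrite /t; apply/andP; split.
    by rewrite mulr_gt0 ?ltr0n// divr_gt0// pi_gt0.
  by rewrite mulrAC ltr_pdivrMr// ltr_pM2l ?pi_gt0 ?ltr_nat.
by rewrite -[cos t ^+ 2](addrK (sin t ^+ 2)) cos2Dsin2; apply/eqP; nra.
Qed.

Lemma zetaX_mod k : zeta ^+ (k %% n) = zeta ^+ k.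
Proof. exact: expr_mod zetaXn. Qed.

Lemma zeta_neq0 : zeta != 0.
Proof.
apply/eqP => z0; have := zetaXn; rewrite z0 expr0n gtn_eqF ?(ltnW hn)//=.
by move/esym/eqP; rewrite oner_eq0.
Qed.

Lemma conj_zeta : zeta^* = zeta^-1.
Proof.
apply: (mulfI zeta_neq0); rewrite divff ?zeta_neq0//.
apply/eqP; rewrite eq_complex/= mulrN opprK -!expr2 cos2Dsin2 eqxx/=.
by apply/eqP; ring.
Qed.

Lemma Zp_castn : (Zp_trunc n).+2 = n.
Proof. exact: Zp_cast. Qed.

(** The sum in ['Z_n] is reduced mod n while the exponents are plain naturals; [zetaXn] absorbs the
    difference. *)
Lemma zetaXD (a b c : 'Z_n) :
  zeta ^+ ((a + b)%R * c) = zeta ^+ (a * c) * zeta ^+ (b * c).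
Proof.
have abE : (a + b)%R = ((a + b) %% n)%N :> nat.
  by congr (_ %% _)%N; exact: Zp_castn.
by rewrite -exprD -mulnDl -[LHS]zetaX_mod abE modnMml zetaX_mod.
Qed.

Definition chi (x y : X) : C := zeta ^+ dot x y.

Lemma chiE x y : chi x y = \prod_i zeta ^+ (x i * y i).
Proof. by rewrite /chi /dot -expr_sum. Qed.

Lemma chiD x x' y : chi (x + x') y = chi x y * chi x' y.
Proof.
by rewrite !chiE -big_split; apply: eq_bigr => i _ /=; rewrite ffunE zetaXD.
Qed.

Lemma chiC x y : chi x y = chi y x.
Proof. by rewrite !chiE; apply: eq_bigr => i _; rewrite mulnC. Qed.

Lemma chi0 y : chi 0 y = 1.
Proof. by rewrite chiE big1// => i _; rewrite ffunE mul0n. Qed.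

Lemma chi_neq0 x y : chi x y != 0.
Proof. by rewrite expf_neq0// zeta_neq0. Qed.

Lemma chiN x y : chi (- x) y = (chi x y)^-1.
Proof.
by apply: (mulfI (chi_neq0 x y)); rewrite -chiD subrr chi0 divff// chi_neq0.
Qed.

Lemma conj_chi x y : (chi x y)^* = chi (- x) y.
Proof. by rewrite chiN /chi rmorphXn/= conj_zeta exprVn. Qed.

Lemma sum_zetaX (b : 'Z_n) :
  \sum_(a : 'Z_n) zeta ^+ (a * b) = if b == 0 then n%:R else 0.
Proof.
case: eqVneq => [->|b0].
  under eq_bigr do rewrite muln0 expr0.
  by rewrite sumr_const card_ord Zp_castn.
set s := \sum_a _.
(* Shifting the summation index by 1 multiplies the sum by a factor different from 1, so the sum
   vanishes. *)
have : zeta ^+ b * s = s.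
  rewrite [in RHS]/s (reindex_inj (addrI (1 : 'Z_n))) mulr_sumr.
  by apply: eq_bigr => a _; rewrite zetaXD /= modn_small ?mul1n// Zp_castn.
move/eqP; rewrite -subr_eq0 -[X in _ - X]mul1r -mulrBl mulf_eq0 subr_eq0.
rewrite (negbTE (zetaX_neq1 _))/=; first by move/eqP.
by rewrite lt0n b0/= -[X in (_ < X)%N]Zp_castn ltn_ord.
Qed.

Lemma sum_chi y : \sum_x chi x y = if y == 0 then (n ^ d)%:R else 0.
Proof.
under eq_bigr do rewrite chiE.
rewrite -(bigA_distr_bigA (fun i (a : 'Z_n) => zeta ^+ (a * y i))).
under eq_bigr do rewrite sum_zetaX.
case: eqVneq => [->|].
  under eq_bigr do rewrite ffunE eqxx.
  by rewrite prodr_const card_ord natrX.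
have [i yi _|y0 /eqP[]] := pickP (fun i => y i != 0).
  by rewrite (bigD1 i)//= (negbTE yi) mul0r.
by apply/ffunP => i; rewrite ffunE; have /negbFE/eqP := y0 i.
Qed.

Lemma hweightE (x : X) : hweight x = (\sum_i (x i != 0%R))%N.
Proof.
rewrite /hweight /hdist -sum1_card big_mkcond; apply: eq_bigr => i _ /=.
by rewrite inE ffunE eq_sym; case: eqP.
Qed.

Lemma hweight_card (x : X) : hweight x = #|[pred i | x i != 0]|.
Proof. by apply: eq_card => i; rewrite !inE ffunE eq_sym. Qed.

Lemma hdistE (x x' : X) : hdist x x' = hweight (x' - x).
Proof.
rewrite hweightE /hdist -sum1_card big_mkcond; apply: eq_bigr => i _ /=.
by rewrite inE !ffunE subr_eq0 eq_sym; case: eqP.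
Qed.

Lemma hweightN (x : X) : hweight (- x) = hweight x.
Proof. by rewrite !hweightE; apply: eq_bigr => i _; rewrite ffunE oppr_eq0. Qed.

Lemma hweight_le (x : X) : (hweight x <= d)%N.
Proof. by rewrite -[X in (_ <= X)%N]card_ord; exact: max_card. Qed.

Lemma coef_1DcXn (c : C) k l : ((1 + c *: 'X) ^+ k)`_l = c ^+ l * 'C(k, l)%:R.
Proof.
rewrite exprDn coef_sum.
have [lk|kl] := ltnP l k.+1; last first.
  rewrite bin_small// mulr0 big1// => i _.
  rewrite expr1n mul1r coefMn exprZn coefZ coefXn.
  by rewrite gtn_eqF ?mulr0 ?mul0rn// (leq_ltn_trans _ kl)// -ltnS.
rewrite (bigD1 (Ordinal lk))//= big1 ?addr0.
  by rewrite expr1n mul1r coefMn exprZn coefZ coefXn eqxx mulr1 mulr_natr.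
move=> i il; rewrite expr1n mul1r coefMn exprZn coefZ coefXn.
by rewrite eq_sym (_ : (i == l :> nat) = false) ?mulr0 ?mul0rn//; apply: negbTE.
Qed.

(* Generating function of the spheres: expanding the product over the
   coordinates gives (1 - 'X)^rho(y) (1 + (n - 1) 'X)^(d - rho(y)). *)
Lemma sphere_gen y :
  \sum_x chi x y *: 'X^(hweight x) =
  (1 + (-1) *: 'X) ^+ hweight y * (1 + (n - 1)%:R *: 'X) ^+ (d - hweight y) :> {poly C}.
Proof.
transitivity (\sum_(x : X) \prod_i (zeta ^+ (x i * y i) *: 'X^(x i != 0%R)) : {poly C}).
  by apply: eq_bigr => x _; rewrite chiE hweightE expr_sum scaler_prod.
rewrite -(bigA_distr_bigA (fun i (a : 'Z_n) => zeta ^+ (a * y i) *: 'X^(a != 0%R) : {poly C})).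
(* The nonzero residues carry the total n - 1 if y_i = 0 and -1 otherwise, since the full character
   sum is n or 0. *)
have coord (i : 'I_d) : \sum_(a : 'Z_n) zeta ^+ (a * y i) *: 'X^(a != 0%R) =
    if y i != 0 then 1 + (-1) *: 'X else 1 + (n - 1)%:R *: 'X :> {poly C}.
  rewrite (bigD1 0)//= mul0n expr0 scale1r.
  under eq_bigr => a a0 do rewrite a0 expr1.
  rewrite -scaler_suml.
  have := sum_zetaX (y i); rewrite (bigD1 0)//= mul0n expr0.
  case: (y i == 0) => /= /(canRL (addKr _)) ->.
  - by rewrite natrB ?(ltnW hn)// [- 1 + _]addrC.
  - by rewrite addr0.
under eq_bigr do rewrite coord.
rewrite big_if/= !prodr_const. congr (_ ^+ _ * _ ^+ _).
  rewrite hweight_card; apply: eq_card => i; by rewrite !inE.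
rewrite hweight_card -[X in (X - _)%N](card_ord d) -(cardC [pred i | y i != 0]) addKn.
by apply: eq_card => i; rewrite !inE.
Qed.

(** Compares coefficients of 'X^j in [sphere_gen]. The convolution runs over all l up to j; outside
    the Krawtchouk range one of the two binomials is zero. *)
Lemma sphere_sum j y :
  \sum_(x | hweight x == j) chi x y = (krawtchouk R d n j (hweight y))%:C.
Proof.
transitivity ((\sum_x chi x y *: 'X^(hweight x) : {poly C})`_j).
  rewrite coef_sum big_mkcond; apply: eq_bigr => x _.
  by rewrite coefZ coefXn eq_sym; case: eqP; rewrite ?mulr1 ?mulr0.
rewrite sphere_gen coefM /krawtchouk rmorph_sum/=.
set h := hweight y.
transitivity (\sum_(0 <= l < j.+1) ((-1) ^+ l * (n - 1)%:R ^+ (j - l) * 'C(h, l)%:R *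
    'C(d - h, j - l)%:R : R)%:C).
  rewrite big_mkord; apply: eq_bigr => l _.
  rewrite !coef_1DcXn !rmorphM !rmorphXn/= rmorphN1 !rmorph_nat.
  by rewrite mulrACA -!mulrA.
rewrite (big_cat_nat _ (n := (minn j h).+1))//=; last by rewrite ltnS geq_minl.
rewrite [X in _ + X]big_nat_cond [X in _ + X]big1 ?addr0; last first.
  move=> l /andP[/andP[ml lj] _]; rewrite [X in _ * X%:R * _]bin_small ?mulr0 ?mul0r//.
  by move: ml lj; rewrite gtn_min; lia.
have vanish l : (l < j + h - d)%N -> ((-1) ^+ l * (n - 1)%:R ^+ (j - l) *
    'C(h, l)%:R * 'C(d - h, j - l)%:R : R)%:C = 0.
  move=> lj; rewrite [X in _ * X%:R]bin_small ?mulr0//.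
  by have := hweight_le y; rewrite -/h; lia.
(* The bounds can cross when [j] exceeds [d]; every remaining term then vanishes. *)
have [jh|jh] := leqP (j + h - d) (minn j h).+1; last first.
  rewrite [RHS]big_geq ?(ltnW jh)// big_nat_cond big1// => l /andP[/andP[_ lj] _].
  by apply: vanish; exact: ltn_trans jh.
rewrite (big_cat_nat _ (n := (j + h - d)%N))//=.
by rewrite big_nat_cond big1 ?add0r// => l /andP[/andP[_ /vanish]].
Qed.

(** At y = 0 every character equals 1, so the sphere sum counts points, and the Krawtchouk sum keeps
    only the term l = 0. *)
Lemma sphere_card j : #|[pred x : X | hweight x == j]| = kappa d n j.
Proof.
have h0 : hweight (0 : X) = 0%N.
  by rewrite hweightE big1// => i _; rewrite ffunE eqxx.
apply: (mulrIn (oner_neq0 C)); rewrite -!/(_%:R).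
have := sphere_sum j 0; rewrite h0.
under eq_bigr do rewrite chiC chi0.
rewrite sumr_const => ->.
rewrite /krawtchouk minn0 addn0 /kappa.
have [jd|dj] := leqP j d; last first.
  by rewrite big_geq ?subn_gt0// bin_small.
rewrite (eqP jd) big_nat1 expr0 mul1r subn0 bin0 mulr1 subn0.
by rewrite -natrX -natrM mulnC rmorph_nat.
Qed.

Lemma kappa_gt0 j : (j <= d)%N -> (0 < kappa d n j)%N.
Proof. by move=> jd; rewrite muln_gt0 bin_gt0 jd expn_gt0 subn_gt0 hn. Qed.

Lemma sphere_nonempty j : (j <= d)%N -> exists y : X, hweight y = j.
Proof.
move=> /kappa_gt0; rewrite -sphere_card => /card_gt0P[y]; rewrite inE => /eqP.
by exists y.
Qed.

(** A point of weight [j] exhibits the value as a sum of kappa_i complex numbers of modulus 1. *)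
Lemma krawtchouk_le i j : (j <= d)%N -> `|krawtchouk R d n i j| <= (kappa d n i)%:R.
Proof.
move=> /sphere_nonempty[y <-].
have nC (a : R) : `|a%:C| = `|a|%:C.
  by rewrite normc_def /= expr0n addr0 sqrtr_sqr.
rewrite -lecR -nC -sphere_sum rmorph_nat -sphere_card -sum1_card natr_sum.
apply: (le_trans (ler_norm_sum _ _ _)); apply: ler_sum => x _.
rewrite /chi normrX (_ : `|zeta| = 1) ?expr1n//.
by rewrite /Defs.zeta normc_def/= cos2Dsin2 sqrtr1.
Qed.

End characters.

(** * Spectral calculus in the Fourier basis *)

Section spectral.
Set Implicit Arguments.
Unset Strict Implicit.
Unset Printing Implicit Defensive.
Variables (R : realType) (d n : nat).
Hypothesis hn : (2 <= n)%N.
Local Notation X := (cube d n).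
Local Notation C := R[i].
Local Notation N := #|cube d n|.
Local Notation toC := (map_mx (real_complex R)).
Implicit Types (f g : X -> C) (x y : X) (J : nat -> R).

Lemma sum_enum_val (V : nmodType) (F : X -> V) :
  \sum_(a < N) F (enum_val a) = \sum_x F x.
Proof. by rewrite [RHS](reindex _ (onW_bij _ (enum_val_bij X))). Qed.

Lemma conj_real_complex (r : R) : (r%:C)^* = r%:C.
Proof. exact: conjc_real. Qed.

Lemma Re_scale (r : R) (u : C) : complex.Re (r%:C * u) = r * complex.Re u.
Proof. by case: u => a b /=; rewrite mul0r subr0. Qed.

Lemma eigenfunE y x : eigenfun R y x = chi R x y / (Num.sqrt (n ^ d)%:R)%:C.
Proof. by []. Qed.

Lemma conj_eigenfun y x :
  (eigenfun R y x)^* = chi R (- x) y / (Num.sqrt (n ^ d)%:R)%:C.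
Proof.
by rewrite eigenfunE rmorphM/= (conj_chi R hn) fmorphV/= conj_real_complex.
Qed.

Lemma conj_eigenfunN y x : (eigenfun R y x)^* = eigenfun R (- y) x.
Proof.
rewrite conj_eigenfun eigenfunE; congr (_ / _).
by rewrite (chiN R hn) [in LHS]chiC [in RHS]chiC (chiN R hn).
Qed.

Lemma sqrtC_sqr : (Num.sqrt (n ^ d)%:R)%:C * (Num.sqrt (n ^ d)%:R)%:C = (n ^ d)%:R :> C.
Proof. by rewrite -rmorphM/= -expr2 sqr_sqrtr ?ler0n// rmorph_nat. Qed.

Lemma eigenfun_orth y y' :
  \sum_x eigenfun R y x * (eigenfun R y' x)^* = (y == y')%:R.
Proof.
have n0 : (n ^ d)%:R != 0 :> C by rewrite pnatr_eq0 expn_eq0 gtn_eqF// ltnW.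
transitivity ((\sum_x chi R x (y - y')) / (n ^ d)%:R : C).
  rewrite mulr_suml; apply: eq_bigr => x _.
  rewrite conj_eigenfunN !eigenfunE mulrACA -invfM sqrtC_sqr.
  by rewrite chiC (chiC _ x) -(chiD R hn) (chiC _ _ x).
rewrite (sum_chi R hn) subr_eq0; case: eqP => _; first by rewrite divff.
by rewrite mul0r.
Qed.

Definition eigenmx : 'M[C]_N := \matrix_(a, b) eigenfun R (enum_val b) (enum_val a).
Definition adjmx : 'M[C]_N := \matrix_(a, b) (eigenfun R (enum_val a) (enum_val b))^*.

Lemma adjmxK : adjmx *m eigenmx = 1%:M.
Proof.
apply/matrixP => a b; rewrite !mxE.
under eq_bigr => c _ do rewrite !mxE mulrC.
rewrite (sum_enum_val (fun x =>
  eigenfun R (enum_val b) x * (eigenfun R (enum_val a) x)^*)).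
by rewrite eigenfun_orth (inj_eq enum_val_inj) eq_sym.
Qed.

Lemma eigenmxK : eigenmx *m adjmx = 1%:M.
Proof. exact: (mulmx1C adjmxK). Qed.

(** The operator with eigenvalue [f y] on the character of [y]. Since [spec] respects linear
    combinations and products, matrix identities below reduce to scalar identities at each [y]. *)
Definition spec f : 'M[C]_N :=
  eigenmx *m diag_mx (\row_b f (enum_val b)) *m adjmx.

Lemma specM f g : spec f *m spec g = spec (fun y => f y * g y).
Proof.
rewrite /spec !mulmxA -(mulmxA _ adjmx eigenmx) adjmxK mulmx1.
rewrite -(mulmxA eigenmx (diag_mx _) (diag_mx _)) mulmx_diag.
by congr (_ *m diag_mx _ *m _); apply/rowP => b; rewrite !mxE.
Qed.

Lemma spec_cst c : spec (fun=> c) = c%:M.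
Proof.
rewrite /spec (_ : diag_mx _ = c%:M); last first.
  by apply/matrixP => a b; rewrite !mxE.
by rewrite mul_mx_scalar -scalemxAl eigenmxK scalemx1.
Qed.

Lemma spec_linear c f g : spec (fun y => c * f y + g y) = c *: spec f + spec g.
Proof.
rewrite /spec scalemxAl scalemxAr -mulmxDl -mulmxDr -linearZ -linearD/=.
by congr (_ *m diag_mx _ *m _); apply/rowP => b; rewrite !mxE.
Qed.

Lemma spec_entry f a b : spec f a b = \sum_y f y * eigenfun R y (enum_val a) *
  (eigenfun R y (enum_val b))^*.
Proof.
rewrite -sum_enum_val !mxE; apply: eq_bigr => c _.
by rewrite mul_mx_diag !mxE [X in X * _]mulrC.
Qed.

Lemma eq_spec f g : f =1 g -> spec f = spec g.
Proof. by move=> fg; congr spec; apply/funext. Qed.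

Lemma spec_eigen A f : A *m eigenmx = eigenmx *m diag_mx (\row_b f (enum_val b)) ->
  A = spec f.
Proof. by move=> AE; rewrite /spec -AE -mulmxA eigenmxK mulmx1. Qed.

Lemma spec_eigencol f y : spec f *m eigencol R y = f y *: eigencol R y.
Proof.
have -> : eigencol R y = col (enum_rank y) eigenmx.
  by apply/colP => a; rewrite !mxE enum_rankK.
rewrite colE /spec -!mulmxA [adjmx *m _]mulmxA adjmxK mul1mx scalemxAr.
congr (_ *m _); rewrite mul_diag_mx; apply/colP => b; rewrite !mxE.
by case: eqP => [->|_]; rewrite ?enum_rankK// !mulr0.
Qed.

Lemma sum_lambda J y :
  \sum_z (weight d n J (hweight z) / (kappa d n (hweight z))%:R)%:C * chi R z y =
  (lambda d n J (hweight y))%:C.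
Proof.
rewrite (partition_big (fun z => inord (hweight z) : 'I_d.+1) xpredT)//=.
rewrite /lambda big_mkord rmorph_sum; apply: eq_bigr => j _ /=.
rewrite rmorphM/= -(sphere_sum R hn) mulr_sumr; apply: eq_big => z.
  by rewrite -val_eqE/= inordK// ltnS hweight_le.
by rewrite -val_eqE/= inordK ?ltnS ?hweight_le// => /eqP ->.
Qed.

Lemma transition_spec J :
  toC (transition d n J) = spec (fun y => (lambda d n J (hweight y))%:C).
Proof.
apply: spec_eigen; apply/matrixP => a b.
rewrite mul_mx_diag !mxE; set x := enum_val a; set y := enum_val b.
under eq_bigr => c _ do rewrite !mxE hdistE.
rewrite (sum_enum_val (fun x' => (weight d n J (hweight (x' - x)) /
  (kappa d n (hweight (x' - x)))%:R)%:C * eigenfun R y x')).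
(* With x' = x + z the entry depends on z only and the character factors: P is a convolution
   operator. *)
rewrite (reindex_inj (addrI x)) -sum_lambda mulr_sumr.
apply: eq_bigr => z _; rewrite addrC addKr !eigenfunE (chiD R hn).
by ring.
Qed.

Section weights.
Variable J : nat -> R.
Hypotheses (hJ : forall i, (1 <= i <= d)%N -> 0 <= J i)
  (hsum : \sum_(1 <= i < d.+1) (kappa d n i)%:R * J i <= 1).

Lemma weight_ge0 j : (j <= d)%N -> 0 <= weight d n J j.
Proof.
move=> jd; rewrite /weight; case: eqVneq => [_|j0]; first by rewrite subr_ge0.
by rewrite mulr_ge0// hJ// lt0n j0.
Qed.

Lemma sum_weight : \sum_(0 <= j < d.+1) weight d n J j = 1.
Proof.
rewrite big_ltn// {1}/weight eqxx.
rewrite [X in _ + X](eq_big_nat _ _ (F2 := fun j => (kappa d n j)%:R * J j)) ?subrK//.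
by move=> j /andP[j0 _]; rewrite /weight gtn_eqF.
Qed.

(** A convex combination, with weights w_j, of the normalised values K_j(i) / kappa_j, all in
    [-1, 1]. *)
Lemma lambda_le1 i : (i <= d)%N -> `|lambda d n J i| <= 1.
Proof.
move=> id; rewrite -sum_weight /lambda (le_trans (ler_norm_sum _ _ _))//.
rewrite big_nat_cond [leRHS]big_nat_cond; apply: ler_sum => j /andP[/andP[_ jd] _].
have k0 : 0 < (kappa d n j)%:R :> R by rewrite ltr0n kappa_gt0.
rewrite normrM normf_div (ger0_norm (weight_ge0 jd)) (gtr0_norm k0).
have K1 : (kappa d n j)%:R^-1 * `|krawtchouk R d n j i| <= 1.
  by rewrite mulrC ler_pdivrMr// mul1r; exact: krawtchouk_le.
by rewrite -mulrA ler_piMr// weight_ge0.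
Qed.

Variable m : R.
Hypothesis hm : 0 < m.
Local Notation alpha := ((1 + m ^+ 2)^-1).
Local Notation lam y := (lambda d n J (hweight y)).
Local Notation eig i := (alpha^-1 - lambda d n J i).

Lemma mass_gt0 : 0 < 1 + m ^+ 2 :> R.
Proof. by rewrite addr_gt0// exprn_gt0. Qed.

Lemma eig_gt0 i : (i <= d)%N -> 0 < eig i.
Proof.
move=> /lambda_le1; rewrite ler_norml invrK => /andP[_ l1].
by have := exprn_gt0 2 hm; lra.
Qed.

Lemma norm_alpha_lambda i : (i <= d)%N -> `|alpha * lambda d n J i| < 1.
Proof.
move=> /lambda_le1 l1; rewrite normrM gtr0_norm ?invr_gt0 ?mass_gt0//.
rewrite mulrC ltr_pdivrMr ?mass_gt0// mul1r (le_lt_trans l1)// ltrDl.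
exact: exprn_gt0.
Qed.

Lemma resolvent_spec :
  toC (1%:M - alpha *: transition d n J) = spec (fun y => (1 - alpha * lam y)%:C).
Proof.
rewrite (@eq_spec _ (fun y => (- alpha%:C) * (lam y)%:C + 1)); last first.
  by move=> y; rewrite rmorphB rmorphM rmorph1 addrC mulNr.
rewrite spec_linear spec_cst -transition_spec.
by rewrite map_mxB map_mxZ/= map_mx1 scaleNr addrC.
Qed.

Lemma laplacian_spec : laplacian d n alpha J = spec (fun y => (eig (hweight y))%:C).
Proof.
rewrite (@eq_spec _ (fun y => (-1) * (lam y)%:C + alpha^-1%:C)); last first.
  by move=> y; rewrite rmorphB addrC mulN1r.
rewrite spec_linear spec_cst -transition_spec scaleN1r [RHS]addrC.
by rewrite /laplacian map_mxB map_scalar_mx.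
Qed.

Lemma resolvent_mulV :
  toC (1%:M - alpha *: transition d n J) *m
  spec (fun y => (1 - alpha * lam y)^-1%:C) = 1%:M.
Proof.
rewrite resolvent_spec specM -[RHS]/(1%:M) -spec_cst; apply: eq_spec => y.
rewrite -rmorphM/= divff ?rmorph1//.
have := norm_alpha_lambda (hweight_le y); rewrite ltr_norml => /andP[_ l1].
by rewrite subr_eq0 gt_eqF.
Qed.

Lemma resolvent_unit : 1%:M - alpha *: transition d n J \in unitmx.
Proof. by rewrite -(map_unitmx (real_complex R)); exact: (mulmx1_unit resolvent_mulV).1. Qed.

Lemma invmx_resolvent :
  toC (invmx (1%:M - alpha *: transition d n J)) =
  spec (fun y => (1 - alpha * lam y)^-1%:C).
Proof.
have uA := (mulmx1_unit resolvent_mulV).1.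
by rewrite map_invmx -[RHS](mulKmx uA) resolvent_mulV mulmx1.
Qed.

(** Matrix entries and eigenvalues are real, so the spectral expansion may be replaced by its real
    part; convergence is then a question in R. *)
Definition pair_coef x x' y : R :=
  complex.Re (eigenfun R y x * (eigenfun R y x')^*).

Lemma spec_real_entry (A : 'M[R]_N) (h : X -> R) x x' :
  toC A = spec (fun y => (h y)%:C) ->
  entry A x x' = \sum_y h y * pair_coef x x' y.
Proof.
move=> AE; have := congr1
  (fun M : 'M[C]_N => complex.Re (M (enum_rank x) (enum_rank x'))) AE.
rewrite mxE /entry /= => ->; rewrite spec_entry !enum_rankK.
rewrite (big_morph (@complex.Re R) (id1 := 0) (op1 := +%R))//; last by case=> ? ? [].
by apply: eq_bigr => y _; rewrite -mulrA Re_scale.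
Qed.

Lemma transitionX_spec t :
  toC (transition d n J ^+ t) = spec (fun y => (lam y ^+ t)%:C).
Proof.
elim: t => [|t IH].
  by rewrite expr0 (_ : 1 = 1%:M)// map_mx1 -spec_cst; apply: eq_spec => y; rewrite expr0.
rewrite exprS (_ : _ * _ = transition d n J *m (transition d n J ^+ t))//.
rewrite map_mxM IH transition_spec specM; apply: eq_spec => y.
by rewrite -rmorphM -exprS.
Qed.

Lemma green_cvg x x' : green_series alpha J x x' @ \oo -->
  entry (invmx (1%:M - alpha *: transition d n J)) x x'.
Proof.
rewrite (spec_real_entry _ _ invmx_resolvent).
have -> : green_series alpha J x x' =
    fun T => \sum_y series (geometric 1 (alpha * lam y)) T * pair_coef x x' y.
  apply/funext => T; rewrite /green_series /series/=.
  under eq_bigr => t _ do rewrite (spec_real_entry _ _ (transitionX_spec t)) mulr_sumr.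
  rewrite exchange_big; apply: eq_bigr => y _ /=; rewrite mulr_suml.
  by apply: eq_bigr => t _; rewrite mul1r exprMn mulrA.
(* The limit passes through the finite sum over modes by induction on the list of modes. *)
rewrite /=; elim: (index_enum _) => [|y r IH].
  by under eq_fun do rewrite big_nil; rewrite big_nil; exact: cvg_cst.
under eq_fun do rewrite big_cons; rewrite big_cons; apply: cvgD => //.
apply: cvgM; last exact: cvg_cst.
rewrite -[(1 - _)^-1]mul1r; apply: cvg_geometric_series.
exact/norm_alpha_lambda/hweight_le.
Qed.

Lemma green_expansion x x' :
  (alpha * entry (invmx (1%:M - alpha *: transition d n J)) x x')%:C =
  \sum_y ((eig (hweight y))^-1)%:C
           * (zeta R n ^+ dot x y / (Num.sqrt (n ^ d)%:R)%:C)
           * (zeta R n ^- dot x' y / (Num.sqrt (n ^ d)%:R)%:C).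
Proof.
transitivity (alpha%:C * toC (invmx (1%:M - alpha *: transition d n J))
  (enum_rank x) (enum_rank x')); first by rewrite mxE -rmorphM.
rewrite invmx_resolvent spec_entry !enum_rankK mulr_sumr; apply: eq_bigr => y _.
have <- : alpha * (1 - alpha * lam y)^-1 = (eig (hweight y))^-1.
  by rewrite invrK -invfM mulrBr mulr1 mulVKf// gt_eqF ?mass_gt0.
by rewrite conj_eigenfun (chiN R hn) rmorphM /= !mulrA.
Qed.

End weights.
End spectral.

(** * Ranks, eigenspaces and the characteristic polynomial *)

Lemma mxrank_diag (F : fieldType) (n : nat) (r : 'rV[F]_n) :
  \rank (diag_mx r) = #|[pred i | r 0 i != 0]|.
Proof.
pose S := [pred i | r 0 i != 0]; pose e (i : 'I_#|S|) : 'I_n := enum_val i.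
pose A : 'M[F]_(#|S|, n) := \matrix_(i, j) (e i == j)%:R.
pose B : 'M[F]_(n, #|S|) := \matrix_(j, i) (r 0 j *+ (e i == j)).
pose D : 'M[F]_#|S| := diag_mx (\row_i r 0 (e i)).
apply/eqP; rewrite eqn_leq; apply/andP; split.
(* Upper bound: the matrix factors through the space indexed by its support. *)
- have -> : diag_mx r = B *m A.
    apply/matrixP => i j; rewrite !mxE.
    have [ri0|ri] := eqVneq (r 0 i) 0.
      by rewrite ri0 mul0rn big1// => k _; rewrite !mxE ri0 mul0rn mul0r.
    have Si : i \in S by [].
    rewrite (bigD1 (enum_rank_in Si i))//= big1 ?addr0 => [|k ki].
      by rewrite !mxE /e enum_rankK_in// eqxx mulr1n mulr_natr.
    rewrite !mxE (_ : (e k == i) = false) ?mulr0n ?mul0r//.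
    apply/negbTE; apply: contra ki => /eqP ek.
    by apply/eqP; rewrite -[LHS](enum_valK_in Si) -/(e k) ek.
  by rewrite (leq_trans (mxrankM_maxl _ _))// rank_leq_col.
(* Lower bound: the submatrix on the support is invertible. *)
- have uD : D \in unitmx.
    rewrite unitmxE det_diag unitfE; apply/prodf_neq0 => i _.
    by rewrite mxE; have := enum_valP i.
  have DE : D = A *m diag_mx r *m A^T.
    apply/matrixP => i j; rewrite mul_mx_diag !mxE (bigD1 (e i))//= big1 ?addr0.
      by rewrite !mxE eqxx mul1r (inj_eq enum_val_inj) eq_sym mulr_natr.
    by move=> k ki; rewrite !mxE eq_sym (negbTE ki) !mul0r.
  rewrite -{1}(mxrank_unit uD) DE (leq_trans (mxrankM_maxl _ _))//.
  exact: mxrankM_maxr.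
Qed.

Section multiplicities.
Set Implicit Arguments.
Unset Strict Implicit.
Unset Printing Implicit Defensive.
Variables (R : realType) (d n : nat).
Hypothesis hn : (2 <= n)%N.
Local Notation X := (cube d n).
Local Notation C := R[i].
Local Notation N := #|cube d n|.
Implicit Types (f g : X -> C) (x y : X) (J : nat -> R).

Lemma eigenmx_unit : eigenmx R d n \in unitmx.
Proof. exact: (mulmx1_unit (eigenmxK R d hn)).1. Qed.

Lemma adjmx_unit : adjmx R d n \in unitmx.
Proof. exact: (mulmx1_unit (eigenmxK R d hn)).2. Qed.

Lemma rank_spec f : \rank (spec f) = #|[pred y | f y != 0]|.
Proof.
rewrite /spec mxrankMfree ?row_free_unit ?adjmx_unit//.
rewrite -mxrank_tr trmx_mul mxrankMfree ?row_free_unit ?unitmx_tr ?eigenmx_unit//.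
rewrite mxrank_tr mxrank_diag -[RHS]sum1_card big_mkcond/=.
rewrite -[RHS]sum_enum_val -[LHS]sum1_card big_mkcond/=.
by apply: eq_bigr => a _; rewrite !inE mxE.
Qed.

(** Rank-nullity for [spec f - a%:M], which is [spec] of the shifted function and whose rank counts
    the [y] with [f y] different from [a]. *)
Lemma rank_eigenspace_spec f (a : C) :
  \rank (eigenspace (spec f)^T a) = #|[pred y | f y == a]|.
Proof.
rewrite /eigenspace mxrank_ker -[a%:M]tr_scalar_mx -linearB mxrank_tr.
have -> : spec f - a%:M = spec (fun y => f y - a).
  rewrite -(spec_cst d hn) -[RHS]addr0 -[in RHS](subrr (spec (fun=> a))).
  rewrite addrA; congr (_ - _).
  rewrite -[in RHS](scale1r (spec (fun=> a))) addrC -(spec_linear _ _ (fun y => f y - a)).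
  by apply: eq_spec => y; rewrite mul1r addrC subrK.
rewrite rank_spec -[X in (X - _)%N](cardC [pred y | f y - a != 0]) addKn.
by apply: eq_card => y; rewrite !inE negbK subr_eq0.
Qed.

Lemma eigenvalue_spec f (a : C) :
  eigenvalue (spec f)^T a <-> exists y, a = f y.
Proof.
rewrite /eigenvalue -mxrank_eq0 rank_eigenspace_spec -lt0n; split.
  by move=> /card_gt0P[y]; rewrite inE => /eqP <-; exists y.
by move=> [y ->]; apply/card_gt0P; exists y; rewrite inE.
Qed.

(** The change of basis is lifted to constant polynomial matrices, where it conjugates the
    characteristic matrix to the diagonal one. *)
Lemma char_poly_spec f : char_poly (spec f) = \prod_y ('X - (f y)%:P).
Proof.
rewrite /char_poly /char_poly_mx /spec.
pose E' := map_mx (@polyC C) (eigenmx R d n).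
pose A' := map_mx (@polyC C) (adjmx R d n).
have EA : E' *m A' = 1%:M by rewrite -map_mxM (eigenmxK R d hn) map_mx1.
set D := diag_mx _.
have -> : 'X%:M - map_mx (@polyC C) (eigenmx R d n *m D *m adjmx R d n) =
   E' *m ('X%:M - map_mx (@polyC C) D) *m A'.
  by rewrite mulmxBr mulmxBl mul_mx_scalar -scalemxAl EA scalemx1 !map_mxM.
rewrite !det_mulmx mulrAC -det_mulmx EA det1 mul1r.
rewrite -/(char_poly_mx D) -/(char_poly D) char_poly_trig ?diag_mx_is_trig//.
rewrite [RHS](reindex _ (onW_bij _ (enum_val_bij X))).
by apply: eq_bigr => a _; rewrite !mxE eqxx mulr1n.
Qed.

(** The family has as many members as the dimension, so spanning suffices, and that is Fourier
    inversion. *)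
Lemma basis_eigencol : basis_of fullv [seq eigencol R y | y : cube d n].
Proof.
rewrite basisEdim size_map -cardE dimvf /dim/= muln1 leqnn andbT.
apply/subvP => v _.
have -> : v = \sum_b (adjmx R d n *m v) b 0 *: eigencol R (enum_val b).
  rewrite -[LHS]mul1mx -(eigenmxK R d hn) -mulmxA.
  apply/colP => a; rewrite mxE summxE; apply: eq_bigr => b _.
  by rewrite !mxE mulrC.
apply: memv_suml => b _; apply: memvZ; apply: memv_span.
by apply/map_f; rewrite mem_enum.
Qed.

Lemma prod_hweight (V : comNzRingType) (F : nat -> V) :
  \prod_(y : X) F (hweight y) = \prod_(i < d.+1) F i ^+ kappa d n i.
Proof.
rewrite (partition_big (fun y => inord (hweight y) : 'I_d.+1) xpredT)//=.
apply: eq_bigr => i _; rewrite -(sphere_card R d hn) -prodr_const.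
by apply: eq_big => y; rewrite ?inE -val_eqE/= inordK ?ltnS ?hweight_le// => /eqP ->.
Qed.

Lemma card_hweight (P : pred nat) :
  #|[pred y : X | P (hweight y)]| = (\sum_(i < d.+1 | P i) kappa d n i)%N.
Proof.
rewrite -sum1_card.
rewrite (partition_big (fun y => inord (hweight y) : 'I_d.+1) (fun i => P i))/=;
  last first.
  by move=> y; rewrite inE inordK// ltnS hweight_le.
apply: eq_bigr => i Pi; rewrite -(sphere_card R d hn) -sum1_card.
apply: eq_bigl => y; rewrite !inE -val_eqE/= inordK ?ltnS ?hweight_le//.
by case: eqP => [->|]; rewrite ?Pi ?andbF.
Qed.

End multiplicities.

(** * The Hamiltonian in Fourier coordinates *)

Section energy.
Set Implicit Arguments.
Unset Strict Implicit.
Unset Printing Implicit Defensive.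
Variables (R : realType) (d n : nat).
Hypothesis hn : (2 <= n)%N.
Local Notation X := (cube d n).
Local Notation C := R[i].
Local Notation N := #|cube d n|.
Variables (J : nat -> R) (m beta : R).
Hypotheses (hJ : forall i, (1 <= i <= d)%N -> 0 <= J i)
  (hsum : \sum_(1 <= i < d.+1) (kappa d n i)%:R * J i <= 1)
  (hm : 0 < m) (hbeta : 0 < beta).
Implicit Types (x y : X) (v xi : X -> R) (z : X -> C).
Local Notation alpha := ((1 + m ^+ 2)^-1).
Local Notation eig y := (alpha^-1 - lambda d n J (hweight y)).
Local Notation jump x x' := (weight d n J (hdist x x') / (kappa d n (hdist x x'))%:R).

Lemma hdistC x x' : hdist x x' = hdist x' x.
Proof. by apply: eq_card => i; rewrite !inE eq_sym. Qed.

Lemma hdist_eq0 x x' : (hdist x x' == 0%N) = (x == x').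
Proof.
apply/idP/eqP => [|->]; last first.
  by rewrite /hdist eq_card0// => i; rewrite !inE eqxx.
rewrite /hdist => /eqP/card0_eq h0; apply/ffunP => i.
by have := h0 i; rewrite !inE => /negbFE/eqP.
Qed.

Lemma hdist_le x x' : (hdist x x' <= d)%N.
Proof. by rewrite -[X in (_ <= X)%N]card_ord; exact: max_card. Qed.

Lemma sum_jump x : \sum_x' jump x x' = 1.
Proof.
rewrite -[RHS](sum_weight d n J) (reindex_inj (addrI x)) big_mkord.
under eq_bigr => u _ do rewrite hdistE addrC addKr.
rewrite (partition_big (fun u => inord (hweight u) : 'I_d.+1) xpredT)//=.
apply: eq_bigr => i _.
have k0 : (kappa d n i)%:R != 0 :> R.
  by rewrite pnatr_eq0 -lt0n kappa_gt0// -ltnS.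
transitivity (\sum_(u : X | hweight u == i) weight d n J i / (kappa d n i)%:R).
  by apply: eq_big => u; rewrite -val_eqE/= inordK ?ltnS ?hweight_le// => /eqP ->.
rewrite sumr_const -[X in _ *+ X]/(#|[pred u : X | hweight u == i]|).
by rewrite (sphere_card R d hn) -[LHS]mulr_natr divfK.
Qed.

(** Identifies H with half the quadratic form of I / alpha - P. When the square is expanded, the row
    and column sums of P are 1, and the mass term raises the diagonal coefficient from 1 to 1 +
    m^2. *)
Lemma hamiltonianE xi : hamiltonian J m xi =
  2^-1 * (alpha^-1 * (\sum_x xi x ^+ 2) - \sum_x \sum_x' jump x x' * (xi x * xi x')).
Proof.
rewrite /hamiltonian.
have -> : \sum_(1 <= i < d.+1)
    J i * \sum_(p : X * X | hdist p.1 p.2 == i) (xi p.1 - xi p.2) ^+ 2 =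
    \sum_x \sum_x' jump x x' * (xi x - xi x') ^+ 2.
  rewrite pair_bigA/= [RHS](partition_big
    (fun p : X * X => inord (hdist p.1 p.2) : 'I_d.+1) xpredT)//=.
  (* Distance 0, absent from H, carries the weight w_0 but a zero difference. *)
  rewrite big_ord_recl/= [X in _ = X + _]big1 ?add0r; last first.
    move=> p; rewrite -val_eqE/= inordK ?ltnS ?hdist_le// hdist_eq0 => /eqP ->.
    by rewrite subrr expr0n mulr0.
  rewrite big_add1 big_mkord; apply: eq_bigr => i _; rewrite mulr_sumr.
  apply: eq_big => p; first by rewrite -val_eqE/= inordK ?ltnS ?hdist_le.
  move=> /eqP ->; congr (_ * _).
  rewrite /weight/= mulrAC divff ?mul1r//.
  by rewrite pnatr_eq0 -lt0n kappa_gt0.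
have sq : \sum_x \sum_x' jump x x' * (xi x - xi x') ^+ 2 =
   2 * \sum_x xi x ^+ 2 - 2 * \sum_x \sum_x' jump x x' * (xi x * xi x').
  transitivity (\sum_x \sum_x' (jump x x' * xi x ^+ 2 + jump x x' * xi x' ^+ 2 -
      2 * (jump x x' * (xi x * xi x')))).
    by apply: eq_bigr => x _; apply: eq_bigr => x' _; ring.
  under eq_bigr => x _ do rewrite sumrB big_split -mulr_sumr/=.
  rewrite sumrB big_split -mulr_sumr/=; congr (_ - _).
  rewrite [X in _ + X]exchange_big/= mulr2n mulrDl !mul1r; congr (_ + _).
    by apply: eq_bigr => x _; rewrite -mulr_suml sum_jump mul1r.
  apply: eq_bigr => x _; rewrite -mulr_suml.
  by under eq_bigr => x' _ do rewrite hdistC; rewrite sum_jump mul1r.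
by rewrite sq invrK; field.
Qed.

(** The map from Fourier coefficients to fields that underlies [gff], for deterministic [z]; the
    algebra is thereby kept apart from the probability. *)
Definition synth z x : C := (Num.sqrt beta)^-1%:C *
  \sum_y z y / (Num.sqrt (eig y))%:C * eigenfun R y x.

Lemma conj_synth z x : (forall y, z (- y) = (z y)^*) -> (synth z x)^* = synth z x.
Proof.
move=> zN; rewrite /synth rmorphM rmorph_sum/= [in RHS](reindex_inj oppr_inj)/=.
congr (_ * _); first by rewrite conj_real_complex.
apply: eq_bigr => y _; rewrite zN hweightN rmorphM/= (conj_eigenfunN R hn).
rewrite rmorphM/=; congr (_ * _ * _); rewrite fmorphV/=; congr (_^-1).
by rewrite conj_real_complex.
Qed.

(** Parseval: the form is the sum of eig |c_y|^2, and dividing z_y by the square root of beta times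
    eig cancels the eigenvalue. *)
Lemma real_quadratic (xi : X -> R) z : (forall x, (xi x)%:C = synth z x) ->
  (hamiltonian J m xi)%:C = (2 * beta)^-1%:C * \sum_y z y * (z y)^*.
Proof.
move=> xiE.
pose c y : C := (Num.sqrt beta)^-1%:C * (z y / (Num.sqrt (eig y))%:C).
have xiS : \col_a (xi (enum_val a))%:C = \sum_y c y *: eigencol R y.
  apply/colP => a; rewrite mxE xiE summxE /synth mulr_sumr.
  by apply: eq_bigr => y _; rewrite !mxE mulrA.
have Lxi : laplacian d n alpha J *m \col_a (xi (enum_val a))%:C =
    \sum_y ((eig y)%:C * c y) *: eigencol R y.
  rewrite xiS mulmx_sumr; apply: eq_bigr => y _.
  rewrite -scalemxAr (laplacian_spec d hn) (spec_eigencol hn) scalerA.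
  by rewrite mulrC.
have quad : (2 * hamiltonian J m xi)%:C =
    \sum_a (xi (enum_val a))%:C *
      (laplacian d n alpha J *m \col_a (xi (enum_val a))%:C) a 0.
  rewrite hamiltonianE mulVKf ?pnatr_eq0// rmorphB rmorphM !rmorph_sum/=.
  rewrite mulr_sumr -sumrB -sum_enum_val; apply: eq_bigr => a _.
  rewrite /laplacian map_mxB map_scalar_mx mulmxBl mul_scalar_mx !mxE/=.
  rewrite mulrBr rmorphXn expr2/= mulrCA; congr (_ - _).
  rewrite rmorph_sum mulr_sumr -sum_enum_val; apply: eq_bigr => b _.
  by rewrite !mxE !rmorphM/=; ring.
apply: (mulfI (_ : 2 != 0 :> C)); first by rewrite pnatr_eq0.
rewrite -[in LHS](rmorph_nat (real_complex R) 2) -rmorphM/= quad Lxi.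
rewrite (_ : 2 * _ = \sum_y c y * ((c y)^* * (eig y)%:C)); last first.
  rewrite mulrA -(rmorph_nat (real_complex R) 2) -rmorphM/= invfM mulVKf ?pnatr_eq0//.
  rewrite mulr_sumr; apply: eq_bigr => y _.
  have e0 : 0 < eig y := eig_gt0 hn hJ hsum hm (hweight_le y).
  have conjV (u : C) : (u^-1)^* = (u^*)^-1 by exact: fmorphV.
  rewrite /c !rmorphM/= conjV !conj_real_complex.
  have bE : beta^-1%:C = (Num.sqrt beta)^-1%:C * (Num.sqrt beta)^-1%:C.
    by rewrite -rmorphM/= -invfM -expr2 sqr_sqrtr// ltW.
  have eE : (eig y)%:C = (Num.sqrt (eig y))%:C * (Num.sqrt (eig y))%:C.
    by rewrite -rmorphM/= -expr2 sqr_sqrtr// ltW.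
  have s0 : (Num.sqrt (eig y))%:C != 0.
    by rewrite fmorph_eq0 gt_eqF// sqrtr_gt0.
  rewrite bE eE; move: s0; move: (Num.sqrt (eig y))%:C => q q0.
  move: (Num.sqrt beta)^-1%:C => p.
  by field.
(* As xi is real, one factor can be replaced by its conjugate, which brings the bilinear form into
   the shape of the orthonormality relation. *)
transitivity (\sum_x (\sum_y' (c y' * eigenfun R y' x)^*) *
    (\sum_y (eig y)%:C * c y * eigenfun R y x)).
  rewrite -[RHS]sum_enum_val; apply: eq_bigr => a _; congr (_ * _); last first.
    by rewrite summxE; apply: eq_bigr => y _; rewrite !mxE.
  rewrite -(conj_real_complex (xi _)).
  have := congr1 (fun M : 'cV_N => M a 0) xiS; rewrite mxE => ->.
  by rewrite summxE rmorph_sum; apply: eq_bigr => y _; rewrite !mxE.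
under eq_bigr => x _ do rewrite big_distrlr.
rewrite exchange_big; apply: eq_bigr => y' _ /=.
rewrite exchange_big/=.
transitivity (\sum_y (c y')^* * (eig y)%:C * c y * (y == y')%:R).
  apply: eq_bigr => y _; rewrite -(eigenfun_orth R hn) mulr_sumr.
  by apply: eq_bigr => x _; rewrite rmorphM/=; ring.
rewrite (bigD1 y')//= eqxx big1 ?addr0 => [|y /negbTE ->]; last by rewrite mulr0.
by rewrite mulr1 [RHS]mulrC mulrAC.
Qed.

Definition self_conj y := - y == y.
(** Chooses from {y, - y} the point enumerated first; a fixed point represents itself. *)
Definition rep y := (enum_rank y <= enum_rank (- y))%N.
Definition sdev y : R := if self_conj y then 1 else Num.sqrt 2^-1.

Lemma sdev_gt0 y : 0 < sdev y.
Proof. by rewrite /sdev; case: ifP => _; rewrite ?sqrtr_gt0. Qed.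

Lemma repN y : ~~ self_conj y -> rep (- y) = ~~ rep y.
Proof.
rewrite /self_conj /rep opprK => yy; rewrite -ltnNge ltn_neqAle andb_idl// => _.
by rewrite (inj_eq val_inj) (inj_eq enum_rank_inj).
Qed.

Lemma rep_self y : self_conj y -> rep y.
Proof. by rewrite /rep => /eqP ->. Qed.

Lemma self_conjN y : self_conj (- y) = self_conj y.
Proof. by rewrite /self_conj opprK eq_sym. Qed.

(* Hermitian family packed into real coordinates: at a representative y of
   {y, - y} the coordinate is Re Z_y, at the other point it is Im Z_(- y). *)
Definition herm_coef y : C := if rep y then 1 else - 'i.
Definition herm_coefN y : C := if rep y then (if self_conj y then 0 else 'i) else 1.
Definition herm v y : C := (v y)%:C * herm_coef y + (v (- y))%:C * herm_coefN y.

Lemma hermN v y : herm v (- y) = (herm v y)^*.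
Proof.
rewrite /herm /herm_coef /herm_coefN opprK self_conjN.
case: (boolP (self_conj y)) => yy.
  have /eqP -> := yy; rewrite (rep_self yy).
  by apply/eqP; rewrite eq_complex/=; apply/andP; split; apply/eqP; ring.
rewrite (repN yy); case: (rep y) => /=;
by apply/eqP; rewrite eq_complex/=; apply/andP; split; apply/eqP; ring.
Qed.

Lemma herm_norm v : \sum_y herm v y * (herm v y)^* =
  (\sum_y v y ^+ 2 / sdev y ^+ 2)%:C.
Proof.
have s2 : Num.sqrt 2^-1 ^+ 2 = 2^-1 :> R by rewrite sqr_sqrtr.
transitivity ((\sum_y (v y ^+ 2 + (if self_conj y then 0 else v (- y) ^+ 2)))%:C).
  rewrite rmorph_sum; apply: eq_bigr => y _.
  rewrite /herm /herm_coef /herm_coefN; case: (boolP (self_conj y)) => yy.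
    rewrite (rep_self yy).
    by apply/eqP; rewrite eq_complex/=; apply/andP; split; apply/eqP; ring.
  case: (rep y) => /=;
  by apply/eqP; rewrite eq_complex/=; apply/andP; split; apply/eqP; ring.
(* Reindexing by y -> - y yields each square of a genuine pair a second time, and 2 is 1 /
   [sdev y ^+ 2] there. *)
congr (_%:C); rewrite big_split/= [X in _ + X](reindex_inj oppr_inj) -big_split.
apply: eq_bigr => y _; rewrite self_conjN opprK /sdev /=; case: self_conj.
  by rewrite expr1n divr1 addr0.
by rewrite s2 invrK; ring.
Qed.

(** Collects both occurrences of [v y], in [herm v y] and in [herm v (- y)]. The total is real, so
    real parts may be taken term by term. *)
Definition field_coef x y : R :=
  complex.Re ((Num.sqrt beta)^-1%:C *
    (herm_coef y / (Num.sqrt (eig y))%:C * eigenfun R y x +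
     herm_coefN (- y) / (Num.sqrt (eig y))%:C * eigenfun R (- y) x)).

Lemma synth_herm v x : synth (herm v) x = (\sum_y field_coef x y * v y)%:C.
Proof.
have im0 : complex.Im (synth (herm v) x) = 0.
  have := conj_synth x (hermN v); case: synth => a b /= [] /eqP.
  by rewrite eq_sym -addr_eq0 -mulr2n mulrn_eq0 => /eqP.
rewrite (complexE (synth _ _)) im0 rmorph0 mulr0 addr0; congr (_%:C).
have -> : synth (herm v) x = \sum_y (v y)%:C * ((Num.sqrt beta)^-1%:C *
    (herm_coef y / (Num.sqrt (eig y))%:C * eigenfun R y x +
     herm_coefN (- y) / (Num.sqrt (eig y))%:C * eigenfun R (- y) x)).
  rewrite /synth mulr_sumr /herm.
  pose e y := eigenfun R y x.
  transitivity (\sum_y (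
      (Num.sqrt beta)^-1%:C * ((v y)%:C * herm_coef y / (Num.sqrt (eig y))%:C * e y) +
      (Num.sqrt beta)^-1%:C *
        ((v (- y))%:C * herm_coefN y / (Num.sqrt (eig y))%:C * e y))).
    by apply: eq_bigr => y _; rewrite -mulrDr -!mulrDl.
  rewrite big_split/= [X in _ + X](reindex_inj oppr_inj) -big_split.
  by apply: eq_bigr => y _ /=; rewrite opprK hweightN /e; ring.
rewrite (big_morph (@complex.Re R) (id1 := 0) (op1 := +%R))//; last by case=> ? ? [].
by apply: eq_bigr => y _; rewrite /field_coef Re_scale mulrC.
Qed.

Lemma energy_herm v :
  beta * hamiltonian J m (fun x => \sum_y field_coef x y * v y) =
  2^-1 * \sum_y v y ^+ 2 / sdev y ^+ 2.
Proof.
apply: (@complexI R); rewrite rmorphM/= (real_quadratic (z := herm v)); last first.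
  by move=> x; rewrite synth_herm.
rewrite herm_norm -!rmorphM/=; congr (_%:C); rewrite mulrA; congr (_ * _).
by rewrite invfM mulrCA divff ?mulr1// gt_eqF.
Qed.

Definition field_mx : 'M[R]_N := \matrix_(a, b) field_coef (enum_val a) (enum_val b).

Lemma linmap_field_mx (t : N.-tuple (measurableTypeR R)) x :
  tnth (linmap field_mx t) (enum_rank x) =
  \sum_y field_coef x y * tnth t (enum_rank y).
Proof.
rewrite tnth_mktuple -sum_enum_val; apply: eq_bigr => b _.
by rewrite mxE enum_rankK enum_valK.
Qed.

Lemma field_mx_unit : field_mx \in unitmx.
Proof.
rewrite -unitmx_tr -row_free_unit -kermx_eq0; apply/eqP/row_matrixP => i.
rewrite row0; set u := row i _.
have u0 : u *m field_mx^T = 0 by apply/sub_kermxP; exact: row_sub.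
pose v y : R := u 0 (enum_rank y).
have Av x : \sum_y field_coef x y * v y = 0.
  have := congr1 (fun M : 'rV_N => M 0 (enum_rank x)) u0; rewrite !mxE => uA.
  rewrite -[RHS]uA -sum_enum_val; apply: eq_bigr => b _.
  by rewrite /v !mxE enum_valK enum_rankK mulrC.
(* A vector in the kernel yields the zero field, of zero energy; the sum of squares then forces it
   to vanish. *)
have := energy_herm v.
rewrite (_ : (fun x => _) = (fun=> 0)); last by apply/funext => x; exact: Av.
have -> : hamiltonian J m ((fun=> 0) : X -> R) = 0.
  rewrite hamiltonianE big1 => [|x _]; last by rewrite expr0n.
  rewrite big1 => [|x _]; first by rewrite mulr0 subr0 mulr0.
  by rewrite big1// => x' _; rewrite !mulr0.
rewrite mulr0.
move/esym/eqP; rewrite mulf_eq0 invr_eq0 pnatr_eq0/= psumr_eq0; last first.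
  by move=> y _; rewrite divr_ge0// sqr_ge0.
move/allP => v0; apply/rowP => b; rewrite [RHS]mxE.
have := v0 (enum_val b) (mem_index_enum _).
by rewrite /= mulf_eq0 invr_eq0 !sqrf_eq0 (gt_eqF (sdev_gt0 _)) orbF /v enum_valK => /eqP.
Qed.

End energy.

Lemma measure_ae_eq_preimage d d' (T : measurableType d) (U : measurableType d')
    (R : realType) (mu : {measure set T -> \bar R}) (f g : T -> U) (B : set U) :
  measurable_fun setT f -> measurable_fun setT g -> measurable B ->
  {ae mu, forall w, f w = g w} -> mu (f @^-1` B) = mu (g @^-1` B).
Proof.
move=> mf mg mB [S [mS S0 fgS]].
have mfB : measurable (f @^-1` B) by rewrite -[X in measurable X]setTI; exact: mf.
have mgB : measurable (g @^-1` B) by rewrite -[X in measurable X]setTI; exact: mg.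
have le (h k : T -> U) : measurable (h @^-1` B) -> measurable (k @^-1` B) ->
    (forall w, ~ S w -> h w = k w) -> (mu (h @^-1` B) <= mu (k @^-1` B))%E.
  move=> mh mk hk; rewrite -[leRHS]adde0 -S0.
  apply: (@le_trans _ _ (mu (k @^-1` B `|` S))); last exact: measureU2.
  apply: le_measure; rewrite ?inE//.
    exact: measurableU.
  move=> w /= Bw; have [Sw|Sw] := pselect (S w); [by right|left].
  by rewrite /= -hk.
apply/eqP; rewrite eq_le !le//; move=> w Sw; [apply: esym|];
  by apply: contrapT => fg; apply: Sw; exact: fgS.
Qed.

(** * The law of the Gaussian field *)

Section gaussian_field.
Set Implicit Arguments.
Unset Strict Implicit.
Unset Printing Implicit Defensive.
Variables (R : realType) (d n : nat).
Hypothesis hn : (2 <= n)%N.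
Local Notation X := (cube d n).
Local Notation C := R[i].
Local Notation N := #|cube d n|.
Local Notation mR := (measurableTypeR R).
Variables (J : nat -> R) (m beta : R).
Hypotheses (hJ : forall i, (1 <= i <= d)%N -> 0 <= J i)
  (hsum : \sum_(1 <= i < d.+1) (kappa d n i)%:R * J i <= 1)
  (hm : 0 < m) (hbeta : 0 < beta).
Implicit Types (x y : X).
Local Notation alpha := ((1 + m ^+ 2)^-1).

Definition density_const : R := \prod_(a < N) normal_peak (sdev R (enum_val a : X)).

Lemma density_const_gt0 : 0 < density_const.
Proof.
by apply: prodr_gt0 => a _; rewrite normal_peak_gt0// gt_eqF// sdev_gt0.
Qed.

(** The exponents add up to minus half the sum of (t_y / s_y)^2, which [energy_herm] turns into the
    energy of the image field. *)
Lemma prod_normal_pdf (t : N.-tuple mR) :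
  \prod_(a < N) normal_pdf 0 (sdev R (enum_val a : X)) (tnth t a) =
  density_const * gibbs_density beta J m (linmap (field_mx d n J m beta) t).
Proof.
under eq_bigr => a _.
  rewrite normal_pdfE ?gt_eqF ?sdev_gt0// /normal_fun subr0.
  over.
rewrite big_split/= -expR_sum; congr (_ * expR _).
rewrite mulNr (_ : (fun x : X => _) =
    fun x => \sum_y field_coef J m beta x y * tnth t (enum_rank y)); last first.
  by apply/funext => x; exact: linmap_field_mx.
rewrite (energy_herm hn hJ hsum hm hbeta (fun y => tnth t (enum_rank y))).
rewrite -sum_enum_val mulr_sumr -sumrN; apply: eq_bigr => a _.
by rewrite enum_valK -mulr_natr mulNr invfM mulrA [in RHS]mulrC.
Qed.

Lemma measurable_gibbs_density :
  measurable_fun setT (gibbs_density (d := d) (n := n) beta J m).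
Proof.
have mt (x : X) : measurable_fun setT (fun v : N.-tuple mR => tnth v (enum_rank x)).
  exact: measurable_tnth.
apply: measurableT_comp => //.
apply: measurable_funM => //; apply: measurable_funD.
- apply: measurable_funM => //; apply: measurable_sum => // i.
  apply: measurable_funM => //; under eq_fun do rewrite -big_filter.
  apply: measurable_sum => // p.
  by apply: measurable_funX; apply: measurable_funB; exact: mt.
- apply: measurable_funM => //; apply: measurable_sum => // x.
  by apply: measurable_funX; exact: mt.
Qed.

Section random.
Context (disp : measure_display) (T : measurableType disp).
Variables (P : probability T R) (Z : X -> T -> C).
Hypothesis hZ : hermitian_gaussian P Z.

(** The point is always a representative; at a fixed point only the real part is ever selected. *)
Definition coord_index y : bool * X := (~~ rep y, if rep y then y else - y).
Definition coord y (w : T) : R :=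
  part (coord_index y).1 (Z (coord_index y).2 w).
Definition coords (w : T) : N.-tuple mR :=
  [tuple coord (enum_val a) w | a < N].

Lemma gff_synth x w :
  gff alpha beta J Z x w = synth J m beta (Z^~ w) x.
Proof. by []. Qed.

Lemma ae_hermitian : {ae P, forall w, forall y, Z (- y) w = (Z y w)^*}.
Proof.
apply: filter_forall => y; have := hermitian_sym hZ (- y).
by apply: filterS => w; rewrite opprK.
Qed.

Lemma ae_herm_coord :
  {ae P, forall w, forall y, Z y w = herm (fun y => coord y w) y}.
Proof.
apply: filterS ae_hermitian => w Zw y.
rewrite /herm /herm_coef /herm_coefN /coord /coord_index /=.
case: (boolP (self_conj y)) => [yy|yy].
  have yE : - y = y by exact/eqP.
  rewrite (rep_self yy) /= mulr1 mulr0 addr0.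
  (* At a fixed point the symmetry makes the imaginary part its own opposite. *)
  have := Zw y; rewrite yE; case: (Z y w) => a b /= [] /eqP.
  by rewrite -addr_eq0 -mulr2n mulrn_eq0/= => /eqP ->.
rewrite (repN yy); case: (boolP (rep y)) => yr /=; rewrite ?opprK.
  case: (Z y w) => a b.
  by apply/eqP; rewrite eq_complex/=; apply/andP; split; apply/eqP; ring.
have -> : Z y w = (Z (- y) w)^* by rewrite -Zw opprK.
case: (Z _ w) => a b.
by apply/eqP; rewrite eq_complex/=; apply/andP; split; apply/eqP; ring.
Qed.

Lemma gff_real x : {ae P, forall w, complex.Im (gff alpha beta J Z x w) = 0}.
Proof.
apply: filterS ae_hermitian => w Zw; rewrite gff_synth.
have := conj_synth hn J m beta x Zw; case: synth => a b /= [] /eqP.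
by rewrite eq_sym -addr_eq0 -mulr2n mulrn_eq0 => /eqP.
Qed.

Lemma measurable_real_gff : measurable_fun setT (real_gff alpha beta J Z).
Proof.
apply/measurable_fun_tnthP => a.
pose x := enum_val a.
pose k y := (Num.sqrt beta)^-1%:C *
  (eigenfun R y x / (Num.sqrt (alpha^-1 - lambda d n J (hweight y)))%:C).
rewrite (_ : _ \o _ = fun w => \sum_y (part false (Z y w) * complex.Re (k y) -
    part true (Z y w) * complex.Im (k y))); last first.
  apply/funext => w; rewrite /= tnth_mktuple gff_synth /synth mulr_sumr.
  rewrite (big_morph (@complex.Re R) (id1 := 0) (op1 := +%R))//; last by case=> ? ? [].
  apply: eq_bigr => y _; transitivity (complex.Re (Z y w * k y)).
    by congr complex.Re; rewrite /k -/x; ring.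
  by case: (Z y w) => p q; case: (k y) => r s.
apply: measurable_sum => // y; apply: measurable_funB; apply: measurable_funM => //;
exact: (hermitian_measurable hZ).
Qed.

Lemma measurable_coord y : measurable_fun setT (coord y : T -> mR).
Proof. exact: (hermitian_measurable hZ). Qed.

Lemma measurable_coords : measurable_fun setT coords.
Proof.
apply/measurable_fun_tnthP => a; rewrite (_ : _ \o _ = coord (enum_val a)).
  exact: measurable_coord.
by apply/funext => w; rewrite /= tnth_mktuple.
Qed.

Lemma coord_law y B : measurable B ->
  P (coord y @^-1` B) =
  (\int[lebesgue_measure]_(x in B) (normal_pdf 0 (sdev R y) x)%:E)%E.
Proof.
move=> mB; rewrite /sdev; case: (boolP (self_conj y)) => yy.
  rewrite -[LHS]/(P ((part (coord_index y).1 \o Z (coord_index y).2) @^-1` B)).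
  rewrite /coord_index (rep_self yy); apply: (hermitian_law_real hZ) => //.
  exact/eqP.
apply: (hermitian_law hZ) => //=.
by case: ifP => _; rewrite ?opprK// eq_sym.
Qed.

Lemma coord_index_inj : injective coord_index.
Proof.
move=> y y' []; case: (rep y); case: (rep y') => //= _.
exact: oppr_inj.
Qed.

Lemma coord_indep (B : 'I_N -> set mR) : (forall a, measurable (B a)) ->
  (P (\bigcap_(a in setT) (coord (enum_val a) @^-1` B a)) =
   \prod_(a < N) P (coord (enum_val a) @^-1` B a))%E.
Proof.
move=> mB.
have repS y : y \in [set y | rep y]%SET -> - y \in [set y | rep y]%SET -> - y = y.
  rewrite !inE => ry; apply: contraTeq => yy.
  by rewrite repN// ry.
pose f (p : bool * X) := if p.1 then - p.2 else p.2.
have fK y : f (coord_index y) = y.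
  by rewrite /f /coord_index /=; case: rep => //=; rewrite opprK.
(* Only the parts actually used as coordinates: imaginary parts at fixed points are left out. [f]
   recovers the coordinate from its index. *)
pose A' : {set bool * X} := coord_index @: [set: X]%SET.
have A'S : A' \subset finset (fun p : bool * X => p.2 \in [set y | rep y]%SET).
  apply/fintype.subsetP => p /imsetP[y _ ->]; rewrite !inE /coord_index/=.
  case: (boolP (rep y)) => // yr; rewrite repN//.
  by apply: contra yr; exact: rep_self.
have := hermitian_indep hZ repS.
move=> /(_ A' (fun p => B (enum_rank (f p))) A'S (fun p => mB _)).
rewrite big_imset/=; last by move=> y y' _ _; exact: coord_index_inj.
move=> PE; transitivity (P (\bigcap_(i in [set` A'])
    ((part i.1 \o Z i.2) @^-1` B (enum_rank (f i))))).
  congr (P _); apply/seteqP; split=> w /= wB.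
    move=> p /imsetP[y _ ->]; have := wB (enum_rank y) I.
    by rewrite enum_rankK fK.
  move=> a _; have := wB (coord_index (enum_val a)).
  by rewrite fK enum_valK; apply; apply: imset_f.
rewrite PE big_set/= (reindex _ (onW_bij _ (enum_val_bij X))).
by apply: eq_bigr => a _; rewrite fK enum_valK.
Qed.

Lemma law_gff : exists2 c : R, 0 < c & forall B, measurable B ->
  P (real_gff alpha beta J Z @^-1` B) =
  (c%:E * \int[lebesgue_tuple N]_(v in B) (gibbs_density beta J m v)%:E)%E.
Proof.
have [c Ac] := scales_lebesgue_linmap (field_mx_unit hn hJ hsum hm hbeta).
have c0 : 0 < c by case: Ac.
exists (density_const * c); first by rewrite mulr_gt0// density_const_gt0.
move=> B mB.
pose A := linmap (field_mx d n J m beta).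
have mAB : measurable (A @^-1` B).
  by rewrite -[X in measurable X]setTI; exact: measurable_linmap.
(* The two vectors agree only where the Hermitian symmetry holds, hence almost surely. *)
have -> : P (real_gff alpha beta J Z @^-1` B) = P (coords @^-1` (A @^-1` B)).
  rewrite -comp_preimage; apply: measure_ae_eq_preimage => //.
  - exact: measurable_real_gff.
  - by apply: measurableT_comp; [exact: measurable_linmap|exact: measurable_coords].
  apply: filterS ae_herm_coord => w Zw; apply/eq_from_tnth => a.
  rewrite -[a]enum_valK linmap_field_mx tnth_mktuple enum_valK.
  rewrite gff_synth (_ : Z^~ w = herm (fun y => coord y w)); last first.
    by apply/funext => y; exact: Zw.
  rewrite (synth_herm hn)/=; apply: eq_bigr => y _.
  by rewrite tnth_mktuple enum_rankK.
have -> := @law_independent_densities R N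
    (fun a => normal_pdf 0 (sdev R (enum_val a : X))) _ _ P
    (fun a => coord (enum_val a)) (fun a => normal_pdf_ge0 _ _)
    (fun a => measurable_normal_pdf _ _) (fun a => measurable_coord _)
    (fun a => @coord_law _) coord_indep _ mAB.
under eq_integral do rewrite prod_normal_pdf EFinM.
rewrite ge0_integralZl//; last 3 first.
- apply/measurable_EFinP; apply: measurable_funTS.
  by apply: (measurableT_comp measurable_gibbs_density); exact: measurable_linmap.
- by move=> t _; rewrite lee_fin expR_ge0.
- by rewrite lee_fin ltW// density_const_gt0.
rewrite (scales_lebesgue_integral (g := fun v => (gibbs_density beta J m v)%:E) Ac mB).
- by rewrite muleA EFinM.
- by apply/measurable_EFinP/measurable_funTS; exact: measurable_gibbs_density.
- by move=> t _; rewrite lee_fin expR_ge0.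
Qed.

(** Evaluating the law on the whole space gives 1 = c times the partition function; its finiteness
    is read off from this without estimating the integral. *)
Lemma partition_functionE : exists2 c : R, 0 < c &
  partition_function d n beta J m = c^-1%:E /\ forall B, measurable B ->
  P (real_gff alpha beta J Z @^-1` B) =
  (c%:E * \int[lebesgue_tuple N]_(v in B) (gibbs_density beta J m v)%:E)%E.
Proof.
have [c c0 lawE] := law_gff; exists c => //; split => //.
have := lawE setT measurableT; rewrite preimage_setT probability_setT.
rewrite -/(partition_function d n beta J m) => cZ.
rewrite -[LHS]mul1e -[1%E](_ : (c^-1%:E * c%:E = 1)%E); last first.
  by rewrite -EFinM mulVf// gt_eqF.
by rewrite -muleA -cZ mule1.
Qed.

Lemma partition_function_pos : (0 < partition_function d n beta J m < +oo)%E.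
Proof.
have [c c0 [-> _]] := partition_functionE.
by rewrite ltry lte_fin invr_gt0 c0.
Qed.

Lemma law_gff_gibbs B : measurable B ->
  P (real_gff alpha beta J Z @^-1` B) = gibbs beta J m B.
Proof.
have [c c0 [ZE lawE]] := partition_functionE.
by move=> /lawE ->; rewrite /gibbs ZE/= invrK.
Qed.

End random.
End gaussian_field.

Theorem theorem2p7 (R : realType) (d n : nat) (beta m : R) (J : nat -> R)
    (hd : (2 <= d)%N) (hn : (2 <= n)%N) (hbeta : 0 < beta) (hm : 0 < m)
    (hJ : forall i, (1 <= i <= d)%N -> 0 <= J i)
    (hsum : \sum_(1 <= i < d.+1) (kappa d n i)%:R * J i <= 1) :
  let alpha : R := (1 + m ^+ 2)^-1 in
  let eig (i : nat) : R := alpha^-1 - lambda d n J i in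
  (* well-definedness of the divisions and square roots below *)
  (forall i, (i <= d)%N -> 0 < eig i) /\
  (* the Green function: convergent series, inverse matrix, and expansion *)
  (1%:M - alpha *: transition d n J \in unitmx /\
   forall x x' : cube d n,
     [/\ cvgn (green_series alpha J x x'),
         green alpha J x x' = entry (invmx (1%:M - alpha *: transition d n J)) x x'
       & (alpha * green alpha J x x')%:C =
         \sum_(y : cube d n) ((eig (hweight y))^-1)%:C
           * (zeta R n ^+ dot x y / (Num.sqrt (n ^ d)%:R)%:C)
           * (zeta R n ^- dot x' y / (Num.sqrt (n ^ d)%:R)%:C)]) /\
  (* the random field is real, and its joint law is the Gibbs measure *)
  (forall (disp : measure_display) (T : measurableType disp)
     (P : probability T R) (Z : cube d n -> T -> R[i]),
     hermitian_gaussian P Z ->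
     [/\ forall x, {ae P, forall w, complex.Im (gff alpha beta J Z x w) = 0},
         measurable_fun setT (real_gff alpha beta J Z),
         (0 < partition_function d n beta J m < +oo)%E
       & forall B, measurable B ->
           P (real_gff alpha beta J Z @^-1` B) = gibbs beta J m B]) /\
  (* orthonormal basis of eigenfunctions *)
  [/\ forall y : cube d n,
        laplacian d n alpha J *m eigencol R y =
          (eig (hweight y))%:C *: eigencol R y,
      forall y y' : cube d n,
        \sum_(x : cube d n) eigenfun R y x * conjc (eigenfun R y' x) =
          (y == y')%:R
    & basis_of fullv [seq eigencol R y | y : cube d n]] /\
  (* eigenvalues and multiplicities; eigenspaces of the library are spaces of
     row vectors, hence the transposes *)
  [/\ forall a : R[i], eigenvalue (laplacian d n alpha J)^T a <->
        exists2 i, (i <= d)%N & a = (eig i)%:C,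
      char_poly (laplacian d n alpha J) =
        \prod_(i < d.+1) ('X - ((eig i)%:C)%:P) ^+ kappa d n i,
      forall y : cube d n,
        #|[pred y' : cube d n | hweight y' == hweight y]| = kappa d n (hweight y),
      forall y : cube d n,
        \rank (eigenspace (laplacian d n alpha J)^T (eig (hweight y))%:C) =
        (\sum_(i < d.+1 | eig i == eig (hweight y)) kappa d n i)%N
    & forall y : cube d n,
        (forall i, (i <= d)%N -> eig i = eig (hweight y) -> i = hweight y) ->
        \rank (eigenspace (laplacian d n alpha J)^T (eig (hweight y))%:C) =
        kappa d n (hweight y)].
Proof.
move=> alpha eig.
have lapE := laplacian_spec d hn J m.
split; first by move=> i; exact: eig_gt0.
split.
  split; first exact: resolvent_unit.
  move=> x x'; have G := @green_cvg _ _ _ hn _ hJ hsum _ hm x x'.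
  have GE : green alpha J x x' = entry (invmx (1%:M - alpha *: transition d n J)) x x'.
    exact: (cvg_lim (@norm_hausdorff _ _) G).
  split; [by apply/cvg_ex; eexists; exact: G|exact: GE|].
  by rewrite GE; exact: green_expansion.
split.
  move=> disp T P Z hZ; split.
  - exact: gff_real.
  - exact: (measurable_real_gff _ _ _ hZ).
  - exact: (partition_function_pos hn hJ hsum hm hbeta hZ).
  - by move=> B; exact: law_gff_gibbs.
have rankE y : \rank (eigenspace (laplacian d n alpha J)^T (eig (hweight y))%:C) =
    (\sum_(i < d.+1 | eig i == eig (hweight y)) kappa d n i)%N.
  rewrite lapE (rank_eigenspace_spec hn).
  rewrite -(card_hweight R d hn (fun i => eig i == eig (hweight y))).
  by apply: eq_card => y'; rewrite !inE (inj_eq (@complexI R)).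
split; first split.
- by move=> y; rewrite lapE (spec_eigencol hn).
- exact: eigenfun_orth.
- exact: basis_eigencol.
split.
- move=> a; rewrite lapE (eigenvalue_spec hn); split.
    by move=> [y ->]; exists (hweight y) => //; exact: hweight_le.
  (* Every sphere of radius at most [d] is inhabited, so each value is attained as an eigenvalue. *)
  by move=> [i id ->]; have [y <-] := sphere_nonempty R hn id; exists y.
- rewrite lapE (char_poly_spec hn).
  exact: (prod_hweight R d hn (fun i => 'X - ((eig i)%:C)%:P)).
- by move=> y; exact: (sphere_card R d hn).
- exact: rankE.
- move=> y inj; rewrite rankE.
  have hy : (hweight y < d.+1)%N by rewrite ltnS hweight_le.
  rewrite (bigD1 (Ordinal hy))//= big1 ?addn0// => i /andP[/eqP ei ni].
  case/eqP: ni; apply: val_inj => /=; apply: inj => //.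
  by rewrite -ltnS.
Qed.
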